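(* Fix $p\ge2$, $\mathbf a=(1,a_2,\dots,a_r)$ and $\tilde{\mathbf a}=(a_2+1,a_3,\dots,a_r)$ tuples of positive integers each with at most two coordinates not in $p\mathbb N$; light faces of hypermaps of type $\tilde{\mathbf a}$ are named $\tilde f_2,\dots,\tilde f_r$. Fix an orientation $O$ with reverse $\tilde O$. Let $\mathcal N$ be the set of pairs $(\mathfrak m,c)$ with $\mathfrak m$ a $p$-hypermap of type $\mathbf a$ and $c$ a corner of $f_2$; let $\tilde{\mathcal N}$ be the set of triples $(\tilde{\mathfrak m},\tilde v,\tilde e)$ with $\tilde{\mathfrak m}$ a $p$-hypermap of type $\tilde{\mathbf a}$, $\tilde v$ a vertex, and $\tilde e$ an edge incident to $\tilde f_2$ leaving $\tilde v$ for $\tilde O$. Define $\Psi_-(\mathfrak m,c)$: using $\tilde O$, let $\gamma$ be the lightest geodesic from the unique corner of $f_1$ to $c^+$; let $d_0$ be the unique edge incident to $f_1$; slit-slide-sew along $\gamma$ from the unique corner of $f_1$ to $c$, additionally matching the unmatched light copy $\ell_1$ of the first edge with $d_0$ (so $f_1$ disappears); output $(\tilde{\mathfrak m},\tilde v,\tilde e)$ where $\tilde{\mathfrak m}$ is the resulting map, $\tilde e$ the edge given by the unmatched dark copy of the last edge of $\gamma$, and $\tilde v$ the origin of $\gamma$ (the origin of the edge $\ell_1$ matched with $d_0$). Define $\Psi_+(\tilde{\mathfrak m},\tilde v,\tilde e)$: using $O$, let $c_{\tilde e}$ be the corner preceding $\tilde e$ and $\tilde\gamma=(\tilde e_1,\dots,\tilde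 e_k)$ the lightest geodesic from $c_{\tilde e}$ to $\tilde v$; slit along $\tilde\gamma$ entering from $c_{\tilde e}$ and stopping at $\tilde v$ without disconnecting the map at $\tilde v$, so that its light copy $(\tilde\ell_1,\dots,\tilde\ell_k)$ and dark copy $(\tilde d_1,\dots,\tilde d_k)$ satisfy $\tilde\ell_k^+=\tilde d_k^+$; sew $\tilde\ell_{i+1}$ to $\tilde d_i$ for $1\le i\le k-1$, so that $\tilde d_k$ becomes a loop whose unmatched side encloses a new light face of degree one, named $f_1$ and marked at its unique corner; replace the unmatched $\tilde\ell_1$ by a corner $c$; output $(\mathfrak m,c)$ where $\mathfrak m$ is the resulting map. Then $\Psi_-:\mathcal N\to\tilde{\mathcal N}$ and $\Psi_+:\tilde{\mathcal N}\to\mathcal N$ are well defined and are inverse bijections.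
   Context: A $p$-hypermap is a plane map (embedding of a finite connected graph, loops and multiple edges allowed, in the sphere up to orientation-preserving homeomorphism) whose faces are shaded dark or light so that adjacent faces have different shades and every dark face has degree $p$; its type is $(b_1,\dots,b_s)$ if it has exactly $s$ light faces numbered in order with degrees $b_1,\dots,b_s$, each carrying a marked corner. The marked corner is treated as a dangling half-edge, so a light face of degree $b$ has $b+1$ corners that can be distinguished. Edges are oriented so that all light faces lie on the same side (light-left orientation: light faces to the left of every edge; light-right: to the right). $e^-,e^+$ denote origin and end of $e$, $c^+$ the vertex of a corner $c$. The corner preceding $e$ is the corner delimited by $e$ and the edge preceding $e$ in the contour of the incident light face. A path is a sequence of edges $(e_1,\dots,e_k)$ with $e_i^+=e_{i+1}^-$ using edges only in the convened orientation; $\vec d(u,w)$ is the minimal length of a path from $u$ to $w$; an edge $e$ is leaving $v$ if $\vec d(v,e^+)=\vec d(v,e^-)+1$. The lightest geodesic from a corner or edge $e_0$ with $e_0^+=v$ to a vertex $v'$ is built greedily: having $e_j$ with $e_j^+\neq v'$, $e_{j+1}$ is, among edges $e$ with $e^-=e_j^+$ and $\vec d(e^+,v')=\vec d(e_j^+,v')-1$, the first met when turning around $e_j^+$ starting from $e_j$ towards the incident light face. Slit-slide-sew along a simple path $(e_1,\dots,e_k)$ from a corner $c$ (with $e_1^-=c^+$) to a corner $c'$ (with $e_k^+=c'^+$): follow the path on the sphere entering from $c$ and exiting through $c'$, slit along it, obtaining a copy $(\ell_1,\dots,\ell_k)$ incident to light faces and a copy $(d_1,\dots,d_k)$ incident to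 dark faces, then sew $\ell_{i+1}$ to $d_i$ for $1\le i\le k-1$, leaving $\ell_1$ and $d_k$ unmatched. *)

(* Defs.v *)
From mathcomp Require Import all_boot all_fingroup.

Set Implicit Arguments.
Unset Strict Implicit.
Unset Printing Implicit Defensive.

(* Every edge of a hypermap has one light side and one dark side, so the map
   is the gluing of its light polygons and its dark polygons along their
   sides.  [light] lists the contours of the light faces f_1, f_2, ...  in
   order; each contour is read in the light-left orientation starting from the
   marked corner, i.e., from the dangling half-edge.  [dark] sends an edge to
   the next one on the contour of its dark face, also in the light-left
   orientation. *)
Record shaded_map := ShadedMap {
  edge : finType;
  light : seq (seq edge);
  dark : {perm edge}
}.

Inductive orientation := LightLeft | LightRight.

Definition reverse (o : orientation) :=
  if o is LightLeft then LightRight else LightLeft.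

Section ShadedMap.

Variable m : shaded_map.
Implicit Types (o : orientation) (e : edge m) (u v w : {set edge m}).

Definition light_face e : seq (edge m) :=
  nth [::] (light m) (find (fun f => e \in f) (light m)).

Definition light_step o e : edge m :=
  if o is LightLeft then next (light_face e) e else prev (light_face e) e.

Definition dark_step o e : edge m :=
  if o is LightLeft then dark m e else (dark m)^-1%g e.

(* Turning around the origin of e (for o), from e and away from its light
   side: cross the dark face of e to reach the edge that precedes e on it,
   which arrives at the origin of e, then cross the light face of that edge.
   This is the next edge with the same origin as e. *)
Definition turn o e : edge m := light_step o (dark_step (reverse o) e).

(* A vertex is represented by the set of edges whose origin it is in the
   light-left orientation, whichever orientation is in use. *)
Definition left_origin e : {set edge m} := [set x | fconnect (turn LightLeft) e x].

Definition origin o e : {set edge m} :=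
  if o is LightLeft then left_origin e
  else left_origin (light_step LightLeft e).

Definition target o e : {set edge m} := origin (reverse o) e.

Definition vertices : {set {set edge m}} := [set left_origin e | e : edge m].

Definition adjacent u w : bool :=
  [exists e, ((u == origin LightLeft e) && (w == target LightLeft e))
          || ((w == origin LightLeft e) && (u == target LightLeft e))].

(* Connected graph embedded in the sphere (Euler characteristic 2), with
   dark faces of degree p and light faces of degrees b. *)
Definition is_hypermap (p : nat) (b : seq nat) : Prop :=
  [/\ perm_eq (flatten (light m)) (enum (edge m)),
      shape (light m) = b,
      forall e, #|porbit (dark m) e| = p,
      {in vertices &, forall u w, connect adjacent u w}
    & #|vertices| + (size (light m) + #|porbits (dark m)|) = #|edge m| + 2].

Fixpoint is_path o u (s : seq (edge m)) w : bool :=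
  if s is e :: s' then (origin o e == u) && is_path o (target o e) s' w
  else u == w.

Definition is_simple_path o u (s : seq (edge m)) w : bool :=
  is_path o u s w && uniq (u :: map (target o) s).

Definition is_dist o u w (n : nat) : Prop :=
  (exists2 s, is_path o u s w & size s = n)
  /\ (forall s, is_path o u s w -> n <= size s).

Definition leaving o v e : Prop :=
  exists n, is_dist o v (origin o e) n /\ is_dist o v (target o e) n.+1.

Definition approaching o v e : Prop :=
  exists n, is_dist o (origin o e) v n.+1 /\ is_dist o (target o e) v n.

(* [lightest_geodesic o v x s]: s is the lightest geodesic to v from the
   corner (or the edge) whose follower in the contour of the incident light
   face, for o, is x.  As x is the first outgoing edge met when turning from
   that corner (or edge) towards that light face, the outgoing edges are met
   in the order x, turn o x, turn o (turn o x), ... *)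
Inductive lightest_geodesic o v : edge m -> seq (edge m) -> Prop :=
| Lightest_end x : origin o x = v -> lightest_geodesic o v x [::]
| Lightest_step x j s :
    origin o x <> v ->
    approaching o v (iter j (turn o) x) ->
    (forall i, i < j -> ~ approaching o v (iter i (turn o) x)) ->
    lightest_geodesic o v (light_step o (iter j (turn o) x)) s ->
    lightest_geodesic o v x (iter j (turn o) x :: s).

End ShadedMap.

(* A light face of degree b with contour f has b + 1 corners, the dangling
   half-edge splitting the marked one in two.  Corner number j (0 <= j <= b) is
   the one met after j edges when reading f; [rot j f] is the contour read
   from that corner. *)
Definition corner_vertex (m : shaded_map) (e0 : edge m) (f : seq (edge m))
    (j : nat) : {set edge m} :=
  origin LightLeft (head e0 (rot j f)).

Record corner_map := CornerMap {
  cmap : shaded_map;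
  corner : nat
}.

Record vertex_edge_map := VertexEdgeMap {
  vemap : shaded_map;
  the_vertex : {set edge vemap};
  the_edge : edge vemap
}.

Definition is_N (p : nat) (a : seq nat) (x : corner_map) : Prop :=
  is_hypermap (cmap x) p a /\ corner x <= size (nth [::] (light (cmap x)) 1).

Definition is_Nt (p : nat) (a : seq nat) (o : orientation)
    (y : vertex_edge_map) : Prop :=
  [/\ is_hypermap (vemap y) p a,
      the_vertex y \in vertices (vemap y),
      the_edge y \in nth [::] (light (vemap y)) 0
    & leaving (reverse o) (the_vertex y) (the_edge y)].

(* Orientation-preserving homeomorphisms preserving the shading, the numbering
   of the light faces and their marked corners. *)
Definition is_iso (m m' : shaded_map) (f : edge m -> edge m') : Prop :=
  [/\ bijective f,
      light m' = map (map f) (light m)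
    & forall e, dark m' (f e) = f (dark m e)].

Definition iso_N (x x' : corner_map) : Prop :=
  (exists f, @is_iso (cmap x) (cmap x') f) /\ corner x = corner x'.

Definition iso_Nt (y y' : vertex_edge_map) : Prop :=
  exists f, [/\ @is_iso (vemap y) (vemap y') f,
                the_vertex y' = f @: the_vertex y
              & the_edge y' = f (the_edge y)].

(* Slitting along a path unglues the light and dark sides of its edges, and
   sewing glues them back differently; the dark polygons do not change, and an
   edge after sewing bears the name of its dark side.  If s = (e_1, ..., e_k),
   then [slide e_0 s] sends e_{i+1} to e_i for 0 <= i < k: it is the renaming
   of the light sides when the light side of e_{i+1} is sewn to the dark side
   of e_i. *)
Definition slide (T : eqType) (e0 : T) (s : seq T) (e : T) : T :=
  if e \in s then nth e0 (e0 :: s) (index e s) else e.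

Definition insert_at (T : Type) (j : nat) (e : T) (f : seq T) : seq T :=
  take j f ++ e :: drop j f.

(* Here (e_1, ..., e_k) = s, and e_{i+1} is sewn to e_i for 0 <= i < k with
   e_0 = d0 the edge incident to f_1.  The dark side of e_k (of d0 if
   k = 0) is left unmatched: it borders f_2, where it is inserted at
   the corner j through which the slit exits. *)
Definition sss_minus (m : shaded_map) (d0 : edge m) (f2 : seq (edge m))
    (fs : seq (seq (edge m))) (j : nat) (s : seq (edge m)) : shaded_map :=
  ShadedMap
    (insert_at j (last d0 s) (map (slide d0 s) f2) :: map (map (slide d0 s)) fs)
    (dark m).

Definition Psi_minus (o : orientation) (x : corner_map) (y : vertex_edge_map)
  : Prop :=
  let m := cmap x in
  let ot := reverse o in
  exists (d0 : edge m) f2 fs s,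
    [/\ light m = [:: d0] :: f2 :: fs,
        lightest_geodesic ot (corner_vertex d0 f2 (corner x)) d0 s,
        is_simple_path ot (origin ot d0) s (corner_vertex d0 f2 (corner x))
      & let mt := sss_minus d0 f2 fs (corner x) s in
        y = @VertexEdgeMap mt (@origin mt ot d0) (last d0 s)].

(* Here (e_1, ..., e_k) = e1 :: s, and e_{i+1} is sewn to e_i for 1 <= i < k.
   The unmatched light side of e_1 is removed from the contour of f_2, and the
   unmatched dark side of e_k borders the new light face f_1.  In [Psi_plus],
   the corner preceding the distinguished edge is the one whose follower in the
   light contour, for o, is that edge. *)
Definition sss_plus (m : shaded_map) (f2 : seq (edge m))
    (fs : seq (seq (edge m))) (e1 : edge m) (s : seq (edge m)) : shaded_map :=
  ShadedMap
    ([:: last e1 s] :: map (slide e1 s) (rem e1 f2) :: map (map (slide e1 s)) fs)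
    (dark m).

Definition Psi_plus (o : orientation) (y : vertex_edge_map) (x : corner_map)
  : Prop :=
  let m := vemap y in
  exists f2 fs (e1 : edge m) s,
    [/\ light m = f2 :: fs,
        lightest_geodesic o (the_vertex y) (the_edge y) (e1 :: s),
        is_simple_path o (origin o (the_edge y)) (e1 :: s) (the_vertex y),
        e1 \in f2
      & x = CornerMap (sss_plus f2 fs e1 s) (index e1 f2)].

(* For A and B taken up to isoA and isoB, the relation F is the graph of a
   function from the classes of A to the classes of B. *)
Definition well_defined (A B : Type) (inA : A -> Prop) (isoA : A -> A -> Prop)
    (inB : B -> Prop) (isoB : B -> B -> Prop) (F : A -> B -> Prop) : Prop :=
  [/\ forall x, inA x -> exists y, F x y,
      forall x y, inA x -> F x y -> inB y
    & forall x x' y y', inA x -> inA x' -> isoA x x' ->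
        F x y -> F x' y' -> isoB y y'].

Definition left_inverse_of (A B : Type) (inA : A -> Prop)
    (isoA : A -> A -> Prop) (F : A -> B -> Prop) (G : B -> A -> Prop) : Prop :=
  forall x y x', inA x -> F x y -> G y x' -> isoA x' x.

(* Main.v *)
Require Import Defs.
From mathcomp Require Import all_boot all_fingroup.

Set Implicit Arguments.
Unset Strict Implicit.
Unset Printing Implicit Defensive.

(** Slitting along a path V_0, ..., V_k cuts each vertex into a light part and a
    dark part, and sliding glues the light part of V_i to the dark part of
    V_{i-1}.  This is local: the number of vertices grows by one, which makes up
    for the disappearance of f_1, and connectedness is preserved.

    For the distances, let l be the distance to c^+ in m.  As the path is the
    lightest geodesic, an edge that starts on the light side of the slit never
    decreases l.  Hence g = l + 1 on the light side and g = l elsewhere is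
    constant on the vertices of the new map and decreases by at most one along
    each edge, so that the slid path is again a geodesic, and the same estimate
    shows that its reverse is the lightest one.  Conversely, if h is the distance
    from v~ in m~, no edge that ends on the light side increases h, and
    h + 1 on the light side, h elsewhere, is a potential on m.  *)

(** * Cyclic sequences *)

(** Only the light permutation changes: dark polygons and the names of their sides stay, and the
    rotation around vertices is determined by [tau (dk x) = L x]. Counting the loop of f_1 as the
    zeroth edge [e 0] of the path makes the surgery the insertion of [e 0] at the exit corner
    followed by one cyclic renaming [sg] of light sides. The same relation serves both
    constructions: one starts from the vertices of [L], the other from those of [Lt], and each
    recovers the same blocks.

    The obstacle is an off-by-one. A potential that loses at most one per edge shows that the slid
    path is a geodesic, but it does not exclude a competing edge that ends on the light side. The
    sharper bound of the potential by the uncorrected distance at the end of the edge, plus one,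
    does; it holds because the edges that start on the light side were rejected by the greedy
    search. Each path being the reverse of the other, uniqueness of lightest geodesics then gives
    both inverse statements, with the identity on edges as isomorphism. *)

Section CyclicBlocks.

Variable T : eqType.
Implicit Types (f : T -> T) (A B : seq T).

Lemma fcycle_cat_cons f A b B :
  fcycle f (A ++ b :: B) =
  [&& sorted (frel f) A, (if A is a :: A' then f (last a A') == b else true),
      path (frel f) b B & f (last b B) == head b A].
Proof.
case: A => [|a A] /=; first by rewrite rcons_path.
by rewrite rcons_cat cat_path /= rcons_path.
Qed.

(** Agreement is asked according to the value [f w] and not to [w]: whether the two rotations
    coincide is later read off the edge that a turn reaches. *)
Lemma fpath_transfer f f' x p :
  (forall w, f w \in p -> f' w = f w) -> path (frel f) x p -> path (frel f') x p.
Proof.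
elim: p x => //= y p IHp x ff' /andP[/eqP fx p_p].
rewrite ff' ?fx ?eqxx ?mem_head //=; apply: IHp p_p => w wp.
by apply: ff'; rewrite inE wp orbT.
Qed.

Lemma fsorted_transfer f f' A :
  (forall w, f w \in behead A -> f' w = f w) ->
  sorted (frel f) A -> sorted (frel f') A.
Proof. by case: A => //= a A; apply: fpath_transfer. Qed.

(** The slit cuts the cycle of a vertex just before [head b A] and just before [b]; the other edges
    are the inner ones, where nothing changes. *)
Lemma uniq_cat_cons_inner A b B x :
  uniq (A ++ b :: B) -> x \in behead A ++ B -> x != b /\ x != head b A.
Proof.
case: A => [|a A] /=.
  by case/andP=> bB _ xB; split; apply: contraNneq bB => <-.
case/andP; rewrite mem_cat inE !negb_or => /and3P[aA ab aB].
rewrite cat_uniq /= => /and4P[_ /norP[bA _] bB _]; rewrite mem_cat.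
case/orP=> [xA|xB]; split.
- by apply: contraNneq bA => <-.
- by apply: contraNneq aA => <-.
- by apply: contraNneq bB => <-.
- by apply: contraNneq aB => <-.
Qed.

Lemma fcycle_inv (S : Type) (F : T -> S) f A x y :
  (forall w, F (f w) = F w) -> fcycle f A -> x \in A -> y \in A -> F x = F y.
Proof.
move=> Ff; case: A => // a A cA.
suff Fa w : w \in a :: A -> F w = F a by move=> /Fa-> /Fa->.
move: cA => /= ; rewrite rcons_path => /andP[pA _].
elim: A a pA {x y} => [|b A IHA] a /=; first by move=> _ /[!inE] /eqP->.
case/andP=> /eqP fa pA; rewrite inE => /predU1P[-> //|/IHA-/(_ pA)->].
by rewrite -fa Ff.
Qed.

Lemma fcycle_cat_iter f A b B x :
  fcycle f (A ++ b :: B) -> x \in A -> exists2 n, n < size A & iter n f (head b A) = x.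
Proof.
case: A => // a A; rewrite fcycle_cat_cons => /and4P[/= pA _ _ _].
rewrite (fpathE pA) -trajectS => /trajectP[n nA ->]; exists n => //.
by rewrite size_traject in nA *.
Qed.

Lemma fcycle_cat_iter_mem f A b B n :
  fcycle f (A ++ b :: B) -> n < size A -> iter n f (head b A) \in A.
Proof.
case: A => // a A; rewrite fcycle_cat_cons => /and4P[/= pA _ _ _] nA.
by rewrite (fpathE pA) -trajectS; apply/trajectP; exists n.
Qed.

Lemma fcycle_cat_iter_size f A b B :
  fcycle f (A ++ b :: B) -> iter (size A) f (head b A) = b.
Proof.
case: A => // a A; rewrite fcycle_cat_cons => /and4P[/= pA /eqP fb _ _].
by rewrite -fb; congr f; rewrite {2}(fpathE pA) last_traject.
Qed.

Lemma fcycle_cat_iter_end f A b B x :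
  fcycle f (A ++ b :: B) -> x \in A -> exists2 n, n < size A & iter n.+1 f x = b.
Proof.
move=> cAB xA; have [n nA <-] := fcycle_cat_iter cAB xA.
exists (size A - n.+1); first by rewrite -subSn // subSS leq_subr.
by rewrite -iterD -subSn // subSS subnK ?(fcycle_cat_iter_size cAB) // ltnW.
Qed.

Lemma fcycle_cat_iter_end_mem f A b B n :
  fcycle f (A ++ b :: B) -> n < size A -> exists2 x, x \in A & iter n.+1 f x = b.
Proof.
move=> cAB nA; exists (iter (size A - n.+1) f (head b A)).
  by apply: fcycle_cat_iter_mem cAB _; rewrite ltn_subrL (leq_ltn_trans _ nA).
by rewrite -iterD subnKC // (fcycle_cat_iter_size cAB).
Qed.

End CyclicBlocks.

Lemma last_orbit (T : finType) (f : T -> T) (x : T) : injective f ->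
  f (last x (fingraph.orbit f x)) = x.
Proof.
move=> injf; have := cycle_orbit injf x.
by rewrite /fingraph.orbit -orderSpred /= rcons_path => /andP[_ /eqP].
Qed.

Lemma head_orbit (T : finType) (f : T -> T) (d x : T) : head d (fingraph.orbit f x) = x.
Proof. by rewrite /fingraph.orbit -orderSpred. Qed.

(** * The two vertex structures of a slit *)

Section Slit.

Variables (E : finType) (L Lt tau taut dk : E -> E).
Variables (k : nat) (e : nat -> E) (z : E) (sg : E -> E).

(* [L z] is the first edge after the corner through which the slit exits. *)
Definition block_head i := if i < k then e i.+1 else L z.

(* In [tau]-cyclic order, [A i] runs from the light successor of the i-th edge of
   the path up to its next edge, and [B i] runs from there back to the i-th edge.
   The vertices of the path are the cycles [A i ++ B i] before sliding, and
   [A 0], [A i.+1 ++ B i] after it; in the latter the last pair is [B k] alone. *)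
Record slit (A B : nat -> seq E) : Prop := Slit {
  slitV i : i <= k -> fcycle tau (A i ++ B i);
  slitW0 : fcycle taut (A 0);
  slitW i : i <= k -> fcycle taut (A i.+1 ++ B i);
  slitAk : A k.+1 = [::];
  slitA0 : e 0 \in A 0;
  slitVhead i : i <= k -> head (block_head i) (A i) = L (e i);
  slitBhead i : i <= k -> B i = block_head i :: behead (B i);
  slitBlast i : i <= k -> last (block_head i) (behead (B i)) = dk (e i);
  slitAA i j x : i <= k -> j <= k -> x \in A i -> x \in A j -> i = j;
  slitBB i j x : i <= k -> j <= k -> x \in B i -> x \in B j -> i = j;
  slitAB i j x : i <= k -> j <= k -> x \in A i -> x \in B j -> False;
  slit_off x : (forall i, i <= k -> x \notin A i ++ B i) -> taut x = tau x
}.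

Hypotheses (injL : injective L) (injdk : injective dk).
Hypotheses (inj_tau : injective tau) (inj_taut : injective taut).
Hypotheses (tauE : forall x, tau (dk x) = L x).
Hypotheses (tautE : forall x, taut (dk x) = Lt x).
Hypothesis e_inj : forall i j, i <= k -> j <= k -> e i = e j -> i = j.
Hypotheses (L0 : L (e 0) = e 0) (z0 : z <> e 0).
Hypothesis sgS : forall i, i < k -> sg (e i.+1) = e i.
Hypothesis sg0 : sg (e 0) = e k.
Hypothesis sgN : forall x, (forall i, i <= k -> x <> e i) -> sg x = x.
Hypothesis LtN : forall x, x <> e 0 -> x <> z -> Lt (sg x) = sg (L x).
Hypotheses (Ltz : Lt (sg z) = e k) (Ltk : Lt (e k) = sg (L z)).

Local Notation orb := fingraph.orbit.

Lemma slit_on_pathP x :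
  (exists2 i, i <= k & x = e i) \/ (forall i, i <= k -> x <> e i).
Proof.
have [/hasP[i]|/hasPn h] := boolP (has (fun i => x == e i) (iota 0 k.+1)).
  by rewrite mem_iota add0n ltnS => ik /eqP; left; exists i.
by right=> i ik; apply/eqP/h; rewrite mem_iota add0n ltnS.
Qed.

Lemma slit_dk_onto w : exists v, w = dk v.
Proof. by have [g _ gK] := injF_bij injdk; exists (g w). Qed.

Lemma slit_sg_off x : (forall i, i <= k -> sg x <> e i) -> sg x = x.
Proof.
case: (slit_on_pathP x) => [[[|i] ik ->]|/sgN//] off.
  by case: (off k); rewrite ?sg0.
by case: (off i); rewrite ?sgS // ltnW.
Qed.

Lemma slit_sg_eqS i x : i < k -> sg x = e i -> x = e i.+1.
Proof.
move=> ik; case: (slit_on_pathP x) => [[[|j] jk ->]|off].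
- by rewrite sg0 => /(e_inj (leqnn k) (ltnW ik)) ki; rewrite ki ltnn in ik.
- by rewrite sgS // => /(e_inj (ltnW jk) (ltnW ik))->.
- by rewrite (sgN off) => /off-/(_ (ltnW ik)).
Qed.

Lemma slit_sg_eqk x : sg x = e k -> x = e 0.
Proof.
case: (slit_on_pathP x) => [[[|j] jk ->]//|off].
- by rewrite sgS // => /(e_inj (ltnW jk) (leqnn k)) ki; rewrite ki ltnn in jk.
- by rewrite (sgN off) => /off-/(_ (leqnn k)).
Qed.

Lemma slit_Lz0 : L z <> e 0.
Proof. by rewrite -{1}L0 => /injL. Qed.

(** The exceptional case is an exit corner that comes right after [e i.+1]: the contour then meets
    the inserted side [e k] first. *)
Lemma slit_Lt_eS i : i < k ->
  Lt (e i) = if e i.+1 == z then e k else sg (L (e i.+1)).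
Proof.
move=> ik; case: eqP => [ez|nz]; first by rewrite -Ltz -ez sgS.
by rewrite -LtN ?sgS // => /(e_inj ik (leq0n k)).
Qed.

(** A turn can change only if it crosses a light face from a path edge, reaches a path edge, or
    passes the exit corner. *)
Lemma slit_taut_same w :
  (forall i, i <= k -> tau w <> e i) -> (forall i, i <= k -> tau w <> L (e i)) ->
  tau w <> L z -> taut w = tau w.
Proof.
have [v ->] := slit_dk_onto w; rewrite tauE tautE => off off' vz.
have voff i : i <= k -> v <> e i by move=> ik vi; case: (off' i); rewrite ?vi.
rewrite -{1}(sgN voff) LtN; [exact: sgN|exact: voff|by move=> zv; rewrite zv in vz].
Qed.

(** The turn that used to leave [A j] for the head of [B j] now reaches [e j]. This is the head of
    the preceding dark block, or of [A 0] itself when [j = 0]: here light parts are passed to the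
    previous vertex. *)
Lemma slit_taut_head j w : (forall i, i <= k -> L z <> e i) ->
  j <= k -> tau w = block_head j -> (forall i, i <= k -> tau w <> L (e i)) ->
  taut w = e j.
Proof.
have [v ->] := slit_dk_onto w; rewrite tauE tautE => zoff jk + off'.
have voff i : i <= k -> v <> e i by move=> ik vi; case: (off' i); rewrite ?vi.
rewrite /block_head; case: ltnP => [ltjk|kj] vj.
  rewrite -{1}(sgN voff) LtN ?vj ?sgS //; first exact: voff.
  by move=> zv; rewrite zv in vj; apply: (zoff j.+1).
have -> : j = k by apply/eqP; rewrite eqn_leq jk.
by rewrite -Ltz -(injL vj) (sgN voff).
Qed.

(** Passing the exit corner now means reaching [e k], so the first hypothesis also excludes [z]. *)
Lemma slit_tau_same w :
  (forall i, i <= k -> taut w <> e i) -> (forall i, i <= k -> taut w <> Lt (e i)) ->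
  tau w = taut w.
Proof.
have [v ->] := slit_dk_onto w; rewrite tauE tautE => off off'.
have voff i : i <= k -> v <> e i by move=> ik vi; case: (off' i); rewrite ?vi.
have vz : v <> z by move=> vz; apply: (off k) => //; rewrite -Ltz -vz (sgN voff).
have vE : Lt v = sg (L v) by rewrite -{1}(sgN voff) LtN //; apply: voff.
by rewrite vE; symmetry; apply: slit_sg_off => i ik; rewrite -vE; apply: off.
Qed.

Lemma slit_tau_head j w : j <= k -> taut w = e j ->
  (forall i, i <= k -> taut w <> Lt (e i)) -> tau w = block_head j.
Proof.
have [v ->] := slit_dk_onto w; rewrite tauE tautE => jk vj off'.
have voff i : i <= k -> v <> e i by move=> ik vi; case: (off' i); rewrite ?vi.
have [vz|vz] := eqVneq v z.
  move: vj; rewrite -{1}(sgN voff) vz Ltz => /(e_inj (leqnn k) jk) <-.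
  by rewrite /block_head ltnn.
move: vj; rewrite -{1}(sgN voff) LtN; [|exact: voff|exact/eqP].
rewrite /block_head; case: ltnP => [ltjk|kj]; first exact: slit_sg_eqS.
have -> : j = k by apply/eqP; rewrite eqn_leq jk.
by move/slit_sg_eqk; rewrite -{1}L0 => /injL/voff-/(_ (leq0n _)).
Qed.

(** * Blocks cut out of the old vertices *)

Section FromV.

Hypothesis Vconn : forall i, i <= k -> fconnect tau (L (e i)) (block_head i).
Hypothesis Vdiff : forall i j, i <= k -> j <= k ->
  fconnect tau (L (e i)) (L (e j)) -> i = j.

Let O i := orb tau (L (e i)).
Let A i := if i <= k then take (index (block_head i) (O i)) (O i) else [::].
Let B i := drop (index (block_head i) (O i)) (O i).

Let AB i : i <= k -> A i ++ B i = O i.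
Proof. by move=> ik; rewrite /A ik cat_take_drop. Qed.

Let Bhead i : i <= k -> B i = block_head i :: behead (B i).
Proof.
move=> ik; have /[!fconnect_orbit] Oi := Vconn ik.
by rewrite /B (drop_nth (block_head i)) ?index_mem // nth_index.
Qed.

Let VE i : i <= k -> A i ++ block_head i :: behead (B i) = O i.
Proof. by move=> ik; rewrite -Bhead // AB. Qed.

Let memV i j : i <= k -> j <= k -> block_head j \in O i -> i = j.
Proof.
move=> ik jk; rewrite -fconnect_orbit => ij; apply: Vdiff => //.
by apply: connect_trans ij _; rewrite fconnect_sym //; apply: Vconn.
Qed.

Let memO i j x : i <= k -> j <= k -> x \in O i -> x \in O j -> i = j.
Proof.
move=> ik jk; rewrite -!fconnect_orbit => ix jx; apply: Vdiff => //.
by apply: connect_trans ix _; rewrite fconnect_sym.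
Qed.

(** The exit corner lies at the last vertex, while [e i.+1] starts at the vertex number [i < k], and
    these vertices are distinct. *)
Let Lz_off i : i <= k -> L z <> e i.
Proof.
case: i => [_|i ik Lzi]; first exact: slit_Lz0.
have zk : block_head k = L z by rewrite /block_head ltnn.
have := @memV i k (ltnW ik) (leqnn k); rewrite zk Lzi -fconnect_orbit.
have := Vconn (ltnW ik); rewrite /block_head ik => -> /(_ isT) ki.
by rewrite ki ltnn in ik.
Qed.

Let headV i : i <= k -> head (block_head i) (A i) = L (e i).
Proof.
move=> ik; have := head_orbit tau (L (e i)) (L (e i)); rewrite -/(O i) -(VE ik).
by case: (A i).
Qed.

Let uniqV i : i <= k -> uniq (A i ++ block_head i :: behead (B i)).
Proof. by move=> ik; rewrite VE // orbit_uniq. Qed.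

Let nbA i x j : i <= k -> x \in A i -> j <= k -> x <> block_head j.
Proof.
move=> ik xA jk xj; have xO : x \in O i by rewrite -AB // mem_cat xA.
have ij : i = j by apply: memV; rewrite // -xj.
move: xA; rewrite xj -ij => uA.
have := uniqV ik; rewrite cat_uniq => /and3P[_ /hasPn/(_ _ (mem_head _ _))/= + _].
by rewrite uA.
Qed.

Let inner i x : i <= k -> x \in behead (A i) ++ behead (B i) ->
  [/\ forall j, j <= k -> x <> e j, forall j, j <= k -> x <> L (e j) & x <> L z].
Proof.
move=> ik xi.
have xO : x \in O i.
  rewrite -VE // mem_cat inE; move: xi; rewrite mem_cat.
  by case/orP=> [/mem_behead->|->]; rewrite ?orbT.
have [xu xh] := uniq_cat_cons_inner (uniqV ik) xi; rewrite headV // in xh.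
have nL j : j <= k -> x <> L (e j).
  move=> jk xj; move: (xO); rewrite xj -fconnect_orbit => /Vdiff ij.
  by rewrite xj ij ?eqxx in xh.
have nb j : j <= k -> x <> block_head j.
  move=> jk xj; move: (xO); rewrite xj => /memV ij.
  by rewrite xj ij ?eqxx in xu.
split=> //; last by move=> xz; apply: (nb k); rewrite // /block_head ltnn.
case=> [_|j jk xj]; first by rewrite -L0; apply: nL.
by apply: (nb j (ltnW jk)); rewrite /block_head jk.
Qed.

Let transfer i w : i <= k -> tau w \in behead (A i) ++ behead (B i) ->
  taut w = tau w.
Proof. by move=> ik /(inner ik)[? ? ?]; apply: slit_taut_same. Qed.

Let VP i : i <= k -> [/\ sorted (frel tau) (A i),
  forall a A', A i = a :: A' -> tau (last a A') = block_head i,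
  path (frel tau) (block_head i) (behead (B i))
  & tau (last (block_head i) (behead (B i))) == L (e i)].
Proof.
move=> ik; have := cycle_orbit inj_tau (L (e i)); rewrite -/(O i) -VE //.
rewrite fcycle_cat_cons headV // => /and4P[? h ? ?]; split=> // a A' AE.
by move: h; rewrite AE => /eqP.
Qed.

Let lastA i a A' : i <= k -> A i = a :: A' -> taut (last a A') = e i.
Proof.
move=> ik AE; have [_ /(_ _ _ AE) tl _ _] := VP ik.
apply: (slit_taut_head Lz_off ik tl) => j jk; rewrite tl => tj.
have ji : j = i by apply: memV => //; rewrite tj /O in_orbit.
have := uniqV ik; rewrite AE /= => /andP[+ _].
have := headV ik; rewrite AE /= => ->.
by rewrite tj ji mem_cat mem_head orbT.
Qed.

Let lastB i : i <= k -> last (block_head i) (behead (B i)) = dk (e i).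
Proof.
by move=> ik; have [_ _ _ /eqP] := VP ik; rewrite -tauE => /inj_tau.
Qed.

Let sortA i : sorted (frel taut) (A i).
Proof.
have [ik|] := leqP i k; last by rewrite /A ltnNge => /negPf->.
have [sA _ _ _] := VP ik; apply: fsorted_transfer sA => w wA.
by apply: (transfer ik); rewrite mem_cat wA.
Qed.

Lemma slit_fromV : exists A B, slit A B.
Proof.
exists A, B; split=> //.
- by move=> i ik; rewrite AB //; apply: cycle_orbit.
- have [sA _ _ _] := VP (leq0n k).
  have := lastA (leq0n k); have := headV (leq0n k); have := sortA 0.
  case: (A 0) => //= a A' pA aE /(_ _ _ erefl) tE.
  by rewrite rcons_path pA /= tE aE L0.
- move=> i ik; rewrite (Bhead ik) fcycle_cat_cons sortA /=.
  have [_ _ pB _] := VP ik; apply/and3P; split.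
  + case AE: (A i.+1) => [//|a A'].
    have ik1 : i < k by move: AE; rewrite /A; case: ltnP.
    by rewrite (lastA ik1 AE) /block_head ik1.
  + by apply: fpath_transfer pB => w wB; apply: (transfer ik); rewrite mem_cat wB orbT.
  + rewrite lastB // tautE; have [ltik|ki] := ltnP i k; last first.
      have -> : i = k by apply/eqP; rewrite eqn_leq ik.
      by rewrite Ltk sgN ?/A ?ltnn //= /block_head ltnn.
    rewrite slit_Lt_eS //; have := headV ltik.
    have := @nbA i.+1; case AE: (A i.+1) => [|a A'] /=.
      (* If [A i.+1] is empty, [L (e i.+1)] is already the next path edge or the exit; sliding
         brings the contour back to the head of [B i]. *)
      move=> _; rewrite /block_head ltik; case: (ltnP i.+1 k) => [ltik1|ki] eE.
        case: (e i.+1 =P z) => [ez|_]; last by rewrite -eE sgS.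
        by case: (Lz_off ltik1); rewrite -ez.
      have ki' : i.+1 = k by apply/eqP; rewrite eqn_leq ki ltik.
      by rewrite (injL eE) eqxx ki'.
    (* Otherwise the head of [A i.+1] is off the path, hence fixed by [sg]. *)
    move=> nb aE; rewrite -aE.
    have an j : j <= k -> a <> block_head j by apply: nb; rewrite ?mem_head.
    have aoff j : j <= k -> a <> e j.
      case: j => [_ a0|j jk aj].
        by have := @Vdiff 0 i.+1; rewrite L0 -aE a0 => /(_ isT ltik (connect0 _ _)).
      by apply: (an j (ltnW jk)); rewrite /block_head jk.
    case: (e i.+1 =P z) => [ez|_]; last by rewrite sgN.
    by case: (an k (leqnn k)); rewrite /block_head ltnn aE ez.
- by rewrite /A ltnn.
- have := headV (leq0n k); rewrite L0; case: (A 0) => [|a A'] /= hE; last first.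
    by rewrite hE mem_head.
  by move: hE; rewrite /block_head; case: ltnP => [k0 /(e_inj k0 (leq0n _))//|_ /slit_Lz0].
- move=> i j x ik jk xi xj; apply: (@memO _ _ x) => //.
    by rewrite -AB // mem_cat xi.
  by rewrite -AB // mem_cat xj.
- move=> i j x ik jk xi xj; apply: (@memO _ _ x) => //.
    by rewrite -AB // mem_cat xi orbT.
  by rewrite -AB // mem_cat xj orbT.
- move=> i j x ik jk xi xj.
  have ij : i = j.
    apply: (@memO _ _ x) => //; first by rewrite -AB // mem_cat xi.
    by rewrite -AB // mem_cat xj orbT.
  rewrite -ij in xj; have := uniqV ik; rewrite -Bhead // cat_uniq.
  by case/and3P=> _ /hasPn/(_ x xj)/=; rewrite xi.
- move=> x off; have toff i y : i <= k -> y \in O i -> tau x <> y.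
    move=> ik yO xy; have := off i ik; rewrite AB // -fconnect_orbit.
    by rewrite (same_fconnect1_r inj_tau) fconnect_orbit xy yO.
  apply: slit_taut_same.
  + case=> [_|i ik].
      by apply: (toff 0); rewrite // /O L0 in_orbit.
    apply: (toff i _ (ltnW ik)); rewrite -fconnect_orbit.
    by have := Vconn (ltnW ik); rewrite /block_head ik.
  + by move=> i ik; apply: (toff i _ ik); apply: in_orbit.
  + apply: (toff k _ (leqnn k)); rewrite -fconnect_orbit.
    by have := Vconn (leqnn k); rewrite /block_head ltnn.
Qed.
End FromV.

(** * Blocks cut out of the new vertices *)

Section FromW.

Hypothesis Wconn : forall i, i < k -> fconnect taut (Lt (e i)) (e i.+1).
(** There is one vertex more than on the old side: [e 0] represents the left-over light part,
    [Lt (e j)] the target of [e j]. *)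
Let r i := if i is j.+1 then Lt (e j) else e 0.
Hypothesis Wdiff : forall i j, i <= k.+1 -> j <= k.+1 ->
  fconnect taut (r i) (r j) -> i = j.

Let O i := orb taut (r i).
(** Length of the light part: the whole of vertex 0, nothing of vertex [k.+1], and everything before
    [e i] in between. *)
Let n i := if i is 0 then size (O 0) else if i <= k then index (e i) (O i) else 0.
Let A i := take (n i) (O i).
Let B i := drop (n i.+1) (O i.+1).

Let memO i j x : i <= k.+1 -> j <= k.+1 -> x \in O i -> x \in O j -> i = j.
Proof.
move=> ik jk; rewrite -!fconnect_orbit => ix jx; apply: Wdiff => //.
by apply: connect_trans ix _; rewrite fconnect_sym.
Qed.

Let eO i : i <= k -> e i \in O i.
Proof.
case: i => [_|i ik]; first exact: in_orbit.
by rewrite -fconnect_orbit; apply: Wconn.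
Qed.

Let LtO i : Lt (e i) \in O i.+1.
Proof. exact: in_orbit. Qed.

Let Lz_off i : i <= k -> L z <> e i.
Proof.
case: i => [_|i ik Lzi]; first exact: slit_Lz0.
have ki : k.+1 = i.
  apply: (@memO _ _ (e i)); rewrite ?(leqW (ltnW ik)) ?(eO (ltnW ik)) //.
  by rewrite -(sgS ik) -Lzi -Ltk LtO.
by rewrite -ki ltnNge leqnSn in ik.
Qed.

Let Ltk' : Lt (e k) = L z.
Proof. by rewrite Ltk sgN. Qed.

Let A0 : A 0 = O 0.
Proof. by rewrite /A /= take_size. Qed.

Let Ak : A k.+1 = [::].
Proof. by rewrite /A /= ltnn take0. Qed.

Let AB i : A i.+1 ++ B i = O i.+1.
Proof. by rewrite cat_take_drop. Qed.

Let Bhead i : i <= k -> B i = block_head i :: behead (B i).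
Proof.
rewrite leq_eqVlt /B /n /block_head => /predU1P[->|ik].
  rewrite !ltnn drop0 -Ltk' -[Lt _ in RHS](head_orbit taut (e 0) (r k.+1)).
  by rewrite -/(O k.+1); have := LtO k; case: (O _).
by rewrite ik (drop_nth (e i.+1)) ?index_mem ?eO // nth_index ?eO.
Qed.

Let WE i : i <= k -> A i.+1 ++ block_head i :: behead (B i) = O i.+1.
Proof. by move=> ik; rewrite -Bhead // AB. Qed.

Let headW i : i <= k -> head (block_head i) (A i.+1) = Lt (e i).
Proof.
move=> ik; have := head_orbit taut (e 0) (Lt (e i)); rewrite -/(O i.+1) -(WE ik).
by case: (A i.+1).
Qed.

Let uniqW i : i <= k -> uniq (A i.+1 ++ block_head i :: behead (B i)).
Proof. by move=> ik; rewrite WE // orbit_uniq. Qed.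

Let inner i x : i <= k -> x \in behead (A i.+1) ++ behead (B i) ->
  (forall j, j <= k -> x <> e j) /\ (forall j, j <= k -> x <> Lt (e j)).
Proof.
move=> ik xi.
have xO : x \in O i.+1.
  rewrite -WE // mem_cat inE; move: xi; rewrite mem_cat.
  by case/orP=> [/mem_behead->|->]; rewrite ?orbT.
have [xu xh] := uniq_cat_cons_inner (uniqW ik) xi; rewrite headW // in xh.
split=> j jk xj.
  have ij : i.+1 = j by apply: (@memO _ _ x); rewrite // ?(leqW jk) // xj eO.
  by rewrite -ij in jk xj; rewrite xj /block_head jk eqxx in xu.
have [ij] : i.+1 = j.+1 by apply: (@memO _ _ x); rewrite // xj LtO.
by rewrite xj ij eqxx in xh.
Qed.

Let inner0 x : x \in behead (A 0) ->
  (forall j, j <= k -> x <> e j) /\ (forall j, j <= k -> x <> Lt (e j)).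
Proof.
rewrite A0 => x0; have xO := mem_behead x0.
have /negP xe : x != e 0.
  have := orbit_uniq taut (e 0); have := head_orbit taut (e 0) (e 0).
  move: x0; rewrite /O /=; case: (orb _ _) => //= a p xp -> /andP[].
  by move=> + _; apply: contraNneq => <-.
split=> j jk xj.
  have ij : 0 = j by apply: (@memO _ _ x); rewrite // ?(leqW jk) // xj eO.
  by rewrite xj -ij eqxx in xe.
by have : 0 = j.+1 by apply: (@memO _ _ x); rewrite // xj LtO.
Qed.

Let transfer i w : i <= k -> taut w \in behead (A i.+1) ++ behead (B i) ->
  tau w = taut w.
Proof. by move=> ik /(inner ik)[? ?]; apply: slit_tau_same. Qed.

Let WP i : i <= k -> [/\ sorted (frel taut) (A i.+1),
  forall a A', A i.+1 = a :: A' -> taut (last a A') = block_head i,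
  path (frel taut) (block_head i) (behead (B i))
  & taut (last (block_head i) (behead (B i))) == Lt (e i)].
Proof.
move=> ik; have := cycle_orbit inj_taut (r i.+1); rewrite -/(O i.+1) -WE //.
rewrite fcycle_cat_cons headW // => /and4P[? h ? ?]; split=> // a A' AE.
by move: h; rewrite AE => /eqP.
Qed.

Let lastB i : i <= k -> last (block_head i) (behead (B i)) = dk (e i).
Proof.
by move=> ik; have [_ _ _ /eqP] := WP ik; rewrite -tautE => /inj_taut.
Qed.

Let lastA i a A' : i <= k -> A i = a :: A' -> tau (last a A') = block_head i.
Proof.
move=> ik AE.
have aO : head (e 0) (A i) = r i.
  case: i ik AE => [_ _|i ik AE]; first by rewrite A0 head_orbit.
  by have := headW (ltnW ik); rewrite AE.
have tl : taut (last a A') = e i.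
  case: i ik AE aO => [_|i ik] AE aO; last first.
    by have [_ /(_ _ _ AE)-> _ _] := WP (ltnW ik); rewrite /block_head ik.
  have := last_orbit (e 0) inj_taut; rewrite -/(O 0) -A0 AE.
  by [].
apply: (slit_tau_head ik tl) => j jk; rewrite tl => tj.
have ij : i = j.+1.
  by apply: (@memO _ _ (e i)); rewrite ?eO // ?(leqW ik) // tj LtO.
subst i; have := uniqW (ltnW ik); rewrite AE /= /block_head ik.
by move: aO; rewrite AE /= => ->; rewrite -tj mem_cat mem_head orbT.
Qed.

Let headV i : i <= k -> head (block_head i) (A i) = L (e i).
Proof.
case: i => [_|i ik].
  have := head_orbit taut (e 0) (e 0); rewrite -/(O 0) -A0 L0.
  by have := eO (leq0n k); rewrite -A0; case: (A 0).
have := slit_Lt_eS ik; have := headW (ltnW ik); case AE: (A i.+1) => [|a A'] /= hE.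
  rewrite -hE {1}/block_head ik; case: eqP => [ez zk|_ /esym].
    have ik' : i.+1 = k by apply: e_inj.
    by rewrite /block_head ik' ltnn -ez ik'.
  rewrite /block_head; case: ltnP => [ik1|ki]; first by move/slit_sg_eqS->.
  have -> : i.+1 = k by apply/eqP; rewrite eqn_leq ik.
  move/slit_sg_eqk; rewrite -{1}L0 => /injL k0.
  by move: ik; rewrite (e_inj _ _ k0).
have aoff j : j <= k -> a <> e j.
  move=> jk aj; have ij : i.+1 = j.
    by apply: (@memO _ _ a); rewrite ?(leqW jk) ?(leqW ik) // ?aj ?eO // -aj hE LtO.
  have := uniqW (ltnW ik); rewrite AE /= /block_head ik mem_cat inE aj ij eqxx.
  by rewrite orbT.
rewrite -hE; case: eqP => [_ /aoff-/(_ (leqnn k))//|_ aE].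
by rewrite aE; apply: slit_sg_off; rewrite -aE.
Qed.

Let sortA i : i <= k -> sorted (frel tau) (A i).
Proof.
case: i => [_|i ik].
  apply: (@fsorted_transfer _ taut) => [w /inner0[? ?]|]; first exact: slit_tau_same.
  have := cycle_orbit inj_taut (e 0); rewrite -/(O 0) -A0.
  by case: (A 0) => //= a A'; rewrite rcons_path => /andP[].
have [sA _ _ _] := WP (ltnW ik); apply: fsorted_transfer sA => w wA.
by apply: (transfer (ltnW ik)); rewrite mem_cat wA.
Qed.

Lemma slit_fromW : exists A B, slit A B.
Proof.
exists A, B; split=> //.
- move=> i ik; rewrite (Bhead ik) fcycle_cat_cons sortA // headV // lastB // tauE eqxx andbT andTb.
  apply/andP; split.
    by case AE: (A i) => [//|a A']; rewrite /= (lastA ik AE).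
  have [_ _ pB _] := WP ik; apply: fpath_transfer pB => w wB.
  by apply: (transfer ik); rewrite mem_cat wB orbT.
- by rewrite A0; apply: cycle_orbit.
- by move=> i ik; rewrite AB; apply: cycle_orbit.
- by rewrite A0 in_orbit.
- move=> i j x ik jk xi xj.
  by apply: (@memO _ _ x); rewrite ?(leqW ik) ?(leqW jk) // (mem_take xi, mem_take xj).
- move=> i j x ik jk xi xj.
  by have [] : i.+1 = j.+1 by apply: (@memO _ _ x); rewrite ?ltnS // (mem_drop xi, mem_drop xj).
- move=> i j x ik jk xi xj.
  have ij : i = j.+1.
    by apply: (@memO _ _ x); rewrite ?(leqW ik) // (mem_take xi, mem_drop xj).
  rewrite ij in xi; have := uniqW jk; rewrite -Bhead // cat_uniq.
  by case/and3P=> _ /hasPn/(_ x xj)/=; rewrite xi.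
- move=> x off; have offO i : i <= k.+1 -> x \notin O i.
    case: i => [_|i ik]; first by have := off 0; rewrite mem_cat A0 => /(_ isT)/norP[].
    rewrite -AB mem_cat negb_or; have := off i ik; rewrite mem_cat => /norP[_ ->].
    case: (ltnP i k) => [/off|ki]; first by rewrite mem_cat => /norP[->].
    by have -> : i = k by [apply/eqP; rewrite eqn_leq ki andbT]; rewrite Ak.
  have toff i y : i <= k.+1 -> y \in O i -> taut x <> y.
    move=> ik yO xy; have := offO i ik; rewrite -fconnect_orbit.
    by rewrite (same_fconnect1_r inj_taut) fconnect_orbit xy yO.
  by symmetry; apply: slit_tau_same => i ik; [apply: (toff i); rewrite ?eO ?leqW|apply: (toff i.+1)].
Qed.

End FromW.
End Slit.

Lemma fconnect_closed (T : finType) (f : T -> T) (P : pred T) x y :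
  (forall w, P w -> P (f w)) -> fconnect f x y -> P x -> P y.
Proof. by move=> Pf /iter_findex <- Px; elim: (findex _ _ _) => //= n; apply: Pf. Qed.

Lemma fcycle_fconnect (T : finType) (f : T -> T) (p : seq T) x y :
  fcycle f p -> fconnect f x y -> x \in p -> y \in p.
Proof. by move=> cp; apply: fconnect_closed; apply: mem_fcycle. Qed.

(** Both images are projections of the image of the pair [(F, G)], and equal kernels make each
    projection injective there. *)
Lemma card_imset_same_kernel (T S S' : finType) (F : T -> S) (G : T -> S') (Q : {set T}) :
  {in Q &, forall x y, F x = F y <-> G x = G y} -> #|F @: Q| = #|G @: Q|.
Proof.
move=> FG; pose H x := (F x, G x).
have -> : F @: Q = fst @: (H @: Q) by rewrite -imset_comp.
have -> : G @: Q = snd @: (H @: Q) by rewrite -imset_comp.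
have HF : {in H @: Q &, injective fst}.
  move=> _ _ /imsetP[x xQ ->] /imsetP[y yQ ->] /= xy.
  by rewrite /H xy; congr pair; apply/FG.
have HG : {in H @: Q &, injective snd}.
  move=> _ _ /imsetP[x xQ ->] /imsetP[y yQ ->] /= xy.
  by rewrite /H xy; congr pair; apply/FG.
by rewrite (card_in_imset HF) (card_in_imset HG).
Qed.

Lemma card_imset_setC (T S : finType) (F : T -> S) (P : {set T}) :
  (forall x y, F x = F y -> x \in P -> y \in P) ->
  #|F @: [set: T]| = #|F @: P| + #|F @: (~: P)|.
Proof.
move=> FP; rewrite -(setUCr P) imsetU cardsU.
suff -> : (F @: P) :&: (F @: (~: P)) = set0 by rewrite cards0 subn0.
apply/setP=> t; rewrite !inE; apply/negP=> /andP[/imsetP[x xP ->] /imsetP[y yP xy]].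
by move: yP; rewrite inE (FP x y).
Qed.

(** * Consequences of a slit: potentials, turns, number of vertices, connectedness *)

Section SlitTheory.

Variables (E : finType) (L tau taut dk : E -> E).
Variables (k : nat) (e : nat -> E) (z : E) (A B : nat -> seq E).
Hypothesis S : slit L tau taut dk k e z A B.
Hypotheses (inj_tau : injective tau) (inj_taut : injective taut).
Local Notation bhead := (block_head L k e z).

Definition lside x := has (fun i => x \in A i) (iota 0 k.+1).
Definition slit_support := [set x | has (fun i => x \in A i ++ B i) (iota 0 k.+1)].

Lemma lsideP x : reflect (exists2 i, i <= k & x \in A i) (lside x).
Proof.
apply: (iffP hasP) => [[i]|[i ik xi]]; last by exists i; rewrite ?mem_iota.
by rewrite mem_iota => ik xi; exists i.
Qed.

Lemma slit_supportP x :
  reflect (exists2 i, i <= k & x \in A i ++ B i) (x \in slit_support).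
Proof.
rewrite inE; apply: (iffP hasP) => [[i]|[i ik xi]]; last by exists i; rewrite ?mem_iota.
by rewrite mem_iota => ik xi; exists i.
Qed.

Lemma lside_A i x : i <= k -> x \in A i -> lside x.
Proof. by move=> ik xi; apply/lsideP; exists i. Qed.

Lemma lside_B i x : i <= k -> x \in B i -> lside x = false.
Proof. by move=> ik xi; apply/lsideP=> -[j jk xj]; apply: (slitAB S jk ik xj xi). Qed.

Lemma slit_dark_mem_B i : i <= k -> dk (e i) \in B i.
Proof. by move=> ik; rewrite (slitBhead S ik) -(slitBlast S ik) mem_last. Qed.

Lemma slit_head_mem_B i : i <= k -> bhead i \in B i.
Proof. by move=> ik; rewrite (slitBhead S ik) mem_head. Qed.

Lemma slit_path_mem_B i : i < k -> e i.+1 \in B i.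
Proof. by move=> ik; have := slit_head_mem_B (ltnW ik); rewrite /block_head ik. Qed.

Lemma slitA_le i x : i <= k.+1 -> x \in A i -> i <= k.
Proof. by rewrite leq_eqVlt => /predU1P[->|]//; rewrite (slitAk S). Qed.

(** The blocks are only regrouped, so the old and the new vertices of the slit cover the same
    edges. *)
Lemma slit_supportWP x :
  reflect (x \in A 0 \/ exists2 i, i <= k & x \in A i.+1 ++ B i) (x \in slit_support).
Proof.
apply: (iffP (slit_supportP x)) => [[i ik]|[x0|[i ik]]].
- rewrite mem_cat => /orP[xi|xi]; last by right; exists i; rewrite // mem_cat xi orbT.
  case: i ik xi => [_|i ik] xi; [by left | right; exists i; first exact: ltnW].
  by rewrite mem_cat xi.
- by exists 0; rewrite // mem_cat x0.
- rewrite mem_cat => /orP[xi|xi]; last by exists i; rewrite // mem_cat xi orbT.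
  by exists i.+1; rewrite ?mem_cat ?xi //; apply: (slitA_le _ xi).
Qed.

Lemma slit_taut_off x : x \notin slit_support -> taut x = tau x.
Proof.
move=> xP; apply: (slit_off S) => i ik; apply: contra xP => xi.
by apply/slit_supportP; exists i.
Qed.

Lemma slit_tau_support x : x \in slit_support -> tau x \in slit_support.
Proof.
case/slit_supportP=> i ik xi; apply/slit_supportP; exists i => //.
exact: (mem_fcycle (slitV S ik)).
Qed.

Lemma slit_taut_support x : x \in slit_support -> taut x \in slit_support.
Proof.
case/slit_supportWP=> [x0|[i ik xi]]; apply/slit_supportWP.
  by left; apply: (mem_fcycle (slitW0 S)).
by right; exists i => //; apply: (mem_fcycle (slitW S ik)).
Qed.

Lemma lside_off x : x \notin slit_support -> lside x = false.
Proof.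
move=> xP; apply/lsideP=> -[i ik xi]; case/negP: xP.
by apply/slit_supportP; exists i; rewrite // mem_cat xi.
Qed.

Lemma slit_tau_supportE x : (tau x \in slit_support) = (x \in slit_support).
Proof.
apply/idP/idP => [tP|]; last exact: slit_tau_support.
apply: (@fconnect_closed _ tau _ (tau x)) tP; first exact: slit_tau_support.
by rewrite fconnect_sym // fconnect1.
Qed.

Lemma slitV_inv (U : Type) (F : E -> U) i x : (forall x, F (tau x) = F x) ->
  i <= k -> x \in A i ++ B i -> F x = F (dk (e i)).
Proof.
move=> Ft ik xi; apply: (fcycle_inv Ft (slitV S ik)) => //.
by rewrite mem_cat slit_dark_mem_B ?orbT.
Qed.

Lemma slitW_inv (U : Type) (F : E -> U) i x : (forall x, F (taut x) = F x) ->
  i <= k -> x \in A i.+1 ++ B i -> F x = F (dk (e i)).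
Proof.
move=> Ft ik xi; apply: (fcycle_inv Ft (slitW S ik)) => //.
by rewrite mem_cat slit_dark_mem_B ?orbT.
Qed.

Lemma slitW0_inv (U : Type) (F : E -> U) x : (forall x, F (taut x) = F x) ->
  x \in A 0 -> F x = F (e 0).
Proof. by move=> Ft x0; apply: (fcycle_inv Ft (slitW0 S)) => //; apply: slitA0 S. Qed.

(* Sliding shifts the distance to the end of the path by one on the light side of
   the slit; correcting for it makes the distance constant on the new vertices. *)
Section ForwardPotential.

Variable l : E -> nat.
Hypotheses (l_tau : forall x, l (tau x) = l x) (l_dk : forall i, i <= k -> l (dk (e i)) = k - i).

Let g x := l x + lside x.

Lemma forward_potential_W0 x : x \in A 0 -> g x = k.+1.
Proof.
move=> x0; rewrite /g (lside_A (leq0n k)) // (slitV_inv l_tau (leq0n k)) ?mem_cat ?x0 //.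
by rewrite l_dk // subn0 addn1.
Qed.

Lemma forward_potential_W i x : i <= k -> x \in A i.+1 ++ B i -> g x = k - i.
Proof.
move=> ik; rewrite mem_cat => /orP[xi|xi].
  have ik1 := @slitA_le i.+1 x ik xi; rewrite /g (lside_A ik1 xi).
  by rewrite (slitV_inv l_tau ik1) ?mem_cat ?xi // l_dk // addn1 subnSK.
by rewrite /g (lside_B ik xi) addn0 (slitV_inv l_tau ik) ?mem_cat ?xi ?orbT // l_dk.
Qed.

Lemma forward_potential_inv x : g (taut x) = g x.
Proof.
have [/slit_supportWP[x0|[i ik xi]]|xP] := boolP (x \in slit_support).
- by rewrite !forward_potential_W0 //; apply: (mem_fcycle (slitW0 S)).
- by rewrite !(forward_potential_W ik) //; apply: (mem_fcycle (slitW S ik)).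
- by rewrite slit_taut_off // /g l_tau !lside_off // slit_tau_supportE.
Qed.

End ForwardPotential.

Section BackwardPotential.

Variable h : E -> nat.
Hypotheses (h_taut : forall x, h (taut x) = h x) (h0 : h (e 0) = 0).
Hypothesis h_dk : forall i, i <= k -> h (dk (e i)) = i.+1.

Let g x := h x + lside x.

Lemma backward_potential_A i x : i <= k -> x \in A i -> h x = i.
Proof.
case: i => [_|i ik] xi; first by rewrite (slitW0_inv h_taut xi) h0.
by rewrite (slitW_inv h_taut (ltnW ik)) ?mem_cat ?xi // h_dk // ltnW.
Qed.

(** [h] is [i] on [A i], which belongs to the new vertex number [i], and [i.+1] on [B i], which
    belongs to the next one; the correction on the light side makes up the difference. *)
Lemma backward_potential_V i x : i <= k -> x \in A i ++ B i -> g x = i.+1.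
Proof.
move=> ik; rewrite mem_cat => /orP[xi|xi].
  by rewrite /g (lside_A ik xi) (backward_potential_A ik xi) addn1.
by rewrite /g (lside_B ik xi) addn0 (slitW_inv h_taut ik) ?mem_cat ?xi ?orbT // h_dk.
Qed.

Lemma backward_potential_inv x : g (tau x) = g x.
Proof.
have [/slit_supportP[i ik xi]|xP] := boolP (x \in slit_support).
  by rewrite !(backward_potential_V ik) //; apply: (mem_fcycle (slitV S ik)).
by rewrite -slit_taut_off // /g h_taut !lside_off // slit_taut_off // slit_tau_supportE.
Qed.

End BackwardPotential.

(** Turns are counted to compare with the greedy search. At an old vertex the search runs through
    [A i] and stops at [block_head i]; at a new one, in the reverse orientation, it meets the edges
    whose dark successors form [A i.+1] and stops at [e i]. *)
Lemma slit_run_V i x : i <= k -> x \in A i ->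
  exists2 n, n < size (A i) & iter n tau (L (e i)) = x.
Proof.
move=> ik xi; have := slitV S ik; rewrite (slitBhead S ik) => cV.
by have [n ? <-] := fcycle_cat_iter cV xi; exists n; rewrite ?(slitVhead S ik).
Qed.

Lemma slit_run_V_mem i n : i <= k -> n < size (A i) -> iter n tau (L (e i)) \in A i.
Proof.
move=> ik nA; have := slitV S ik; rewrite (slitBhead S ik) => cV.
by rewrite -(slitVhead S ik); apply: fcycle_cat_iter_mem cV nA.
Qed.

Lemma slit_run_V_size i : i <= k -> iter (size (A i)) tau (L (e i)) = bhead i.
Proof.
move=> ik; have := slitV S ik; rewrite (slitBhead S ik) => cV.
by rewrite -(fcycle_cat_iter_size cV) (slitVhead S ik).
Qed.

Lemma slit_run_W i x : i < k -> x \in A i.+1 ->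
  exists2 n, n < size (A i.+1) & iter n.+1 taut x = e i.+1.
Proof.
move=> ik xi; have := slitW S (ltnW ik); rewrite (slitBhead S (ltnW ik)) => cW.
by have [n ? nE] := fcycle_cat_iter_end cW xi; exists n; rewrite // nE /block_head ik.
Qed.

Lemma slit_run_W_mem i n : i < k -> n < size (A i.+1) ->
  exists2 x, x \in A i.+1 & iter n.+1 taut x = e i.+1.
Proof.
move=> ik nA; have := slitW S (ltnW ik); rewrite (slitBhead S (ltnW ik)) => cW.
by have [x ? xE] := fcycle_cat_iter_end_mem cW nA; exists x; rewrite // xE /block_head ik.
Qed.

Lemma slit_run_W_size i : i < k -> iter (size (A i.+1)).+1 taut (dk (e i)) = e i.+1.
Proof.
move=> ik; have := slitW S (ltnW ik); rewrite (slitBhead S (ltnW ik)) => cW.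
have := cW; rewrite fcycle_cat_cons (slitBlast S (ltnW ik)) => /and4P[_ _ _ /eqP tE].
by rewrite iterSr tE (fcycle_cat_iter_size cW) /block_head ik.
Qed.

Lemma slitV_diff i j : i <= k -> j <= k -> fconnect tau (dk (e i)) (dk (e j)) -> i = j.
Proof.
move=> ik jk /(fcycle_fconnect (slitV S ik)); rewrite !mem_cat slit_dark_mem_B // orbT.
case/(_ isT)/orP=> xi.
  by case: (slitAB S ik jk xi (slit_dark_mem_B jk)).
exact: (slitBB S ik jk xi (slit_dark_mem_B jk)).
Qed.

Let rW i := if i is j.+1 then dk (e j) else e 0.

Lemma slitW_diff i j : i <= k.+1 -> j <= k.+1 -> fconnect taut (rW i) (rW j) -> i = j.
Proof.
wlog: i j / i <= j => [W|].
  have [ij|ji] := leqP i j; first exact: W.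
  by move=> ik jk; rewrite fconnect_sym // => ij; symmetry; apply: W => //; apply: ltnW.
case: j => [|j]; first by rewrite leqn0 => /eqP.
case: i => [_ _ jk|i _ ik jk].
  move/(fcycle_fconnect (slitW0 S))/(_ (slitA0 S)) => xi.
  by case: (slitAB S (leq0n k) jk xi (slit_dark_mem_B jk)).
move/(fcycle_fconnect (slitW S ik)); rewrite !mem_cat slit_dark_mem_B // orbT.
case/(_ isT)/orP=> xi.
  by case: (slitAB S (@slitA_le i.+1 _ ik xi) jk xi (slit_dark_mem_B jk)).
by rewrite (slitBB S ik jk xi (slit_dark_mem_B jk)).
Qed.

(** Orbits that avoid the support are common to both rotations. On the support they are represented
    by the [k.+1] edges [dk (e i)] before sliding, and by these together with [e 0] after it. *)
Lemma slit_card_orbits (U U' : finType) (F : E -> U) (Ft : E -> U') :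
  (forall x y, F x = F y <-> fconnect tau x y) ->
  (forall x y, Ft x = Ft y <-> fconnect taut x y) ->
  #|Ft @: [set: E]| = #|F @: [set: E]|.+1.
Proof.
move=> FE FtE.
have Ft' x : F (tau x) = F x by apply/FE; rewrite fconnect_sym // fconnect1.
have Ftt x : Ft (taut x) = Ft x by apply/FtE; rewrite fconnect_sym // fconnect1.
rewrite (@card_imset_setC _ _ F slit_support); last first.
  by move=> x y /FE; apply: fconnect_closed; apply: slit_tau_support.
rewrite (@card_imset_setC _ _ Ft slit_support); last first.
  by move=> x y /FtE; apply: fconnect_closed; apply: slit_taut_support.
have offP (x y : E) (xP : x \notin slit_support) :
    fconnect taut x y = fconnect tau x y.
  have it n : iter n taut x = iter n tau x /\ iter n tau x \notin slit_support.
    elim: n => //= n [-> nP]; rewrite slit_taut_off //; split=> //.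
    by rewrite slit_tau_supportE.
  apply/idP/idP => /iter_findex <-; first by rewrite (it _).1 fconnect_iter.
  by rewrite -(it _).1 fconnect_iter.
rewrite (@card_imset_same_kernel _ _ _ Ft F (~: slit_support)); last first.
  move=> x y; rewrite inE => xP _.
  by split=> [/FtE|/FE] xy; [apply/FE|apply/FtE]; rewrite ?offP // -?offP.
rewrite -addSn; congr (_ + _).
have -> : F @: slit_support = [set F (dk (e (i : 'I_k.+1))) | i : 'I_k.+1].
  apply/setP=> t; apply/imsetP/imsetP => [[x /slit_supportP[i ik xi] ->]|[i _ ->]].
    by exists (Ordinal (ik : i < k.+1)); rewrite // (slitV_inv Ft' ik xi).
  exists (dk (e i)) => //; apply/slit_supportP; exists i; first exact: ltn_ord i.
  by rewrite mem_cat slit_dark_mem_B ?orbT //; apply: ltn_ord i.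
have -> : Ft @: slit_support = [set Ft (rW (i : 'I_k.+2)) | i : 'I_k.+2].
  apply/setP=> t; apply/imsetP/imsetP => [[x /slit_supportWP[x0|[i ik xi]] ->]|[[[|i] ik] _ ->]].
  - by exists ord0; rewrite // (slitW0_inv Ftt x0).
  - have ik2 : i.+1 < k.+2 by rewrite !ltnS.
    by exists (Ordinal ik2); rewrite // (slitW_inv Ftt ik xi).
  - by exists (e 0) => //; apply/slit_supportWP; left; apply: slitA0 S.
  - exists (dk (e i)) => //; apply/slit_supportWP; right; exists i => //.
    by rewrite mem_cat slit_dark_mem_B ?orbT.
rewrite !card_imset ?card_ord // => i j.
  by move/FE => ij; apply/val_inj/slitV_diff; rewrite // -ltnS ltn_ord.
by move/FtE => ij; apply/val_inj/slitW_diff; rewrite // -ltnS ltn_ord.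
Qed.

(** For permutations [dk] and [f], this says that they generate a transitive group: connectedness
    expressed without vertices or paths. *)
Definition bitransitive (f : E -> E) := forall K : pred E,
  (forall x, K (dk x) = K x) -> (forall x, K (f x) = K x) -> forall x y, K x = K y.

(** An invariant predicate is constant on the support, because [B i] contains both [dk (e i)] and
    [e i.+1] and thus links consecutive path edges; elsewhere the two rotations agree. *)
Lemma slit_bitransitiveW : bitransitive tau -> bitransitive taut.
Proof.
move=> tr K Kdk Kt; apply: tr => // x.
have KB i y : i <= k -> y \in A i.+1 ++ B i -> K y = K (e 0).
  move=> ik /(slitW_inv Kt ik) ->; rewrite Kdk; elim: i ik => // i IHi ik.
  rewrite -(IHi (ltnW ik)) -[K (e i)]Kdk; apply: (slitW_inv Kt (ltnW ik)).
  by rewrite mem_cat slit_path_mem_B ?orbT.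
have KP y : y \in slit_support -> K y = K (e 0).
  by case/slit_supportWP=> [/(slitW0_inv Kt)//|[i ik /(KB i)->]].
have [xP|xP] := boolP (x \in slit_support); first by rewrite !KP // slit_tau_support.
by rewrite -slit_taut_off.
Qed.

Lemma slit_bitransitiveV : bitransitive taut -> bitransitive tau.
Proof.
move=> tr K Kdk Kt; apply: tr => // x.
have KV i : i <= k -> K (dk (e i)) = K (e 0).
  elim: i => [_|i IHi ik]; first by rewrite Kdk.
  rewrite -(IHi (ltnW ik)) Kdk; apply: (slitV_inv Kt (ltnW ik)).
  by rewrite mem_cat slit_path_mem_B ?orbT.
have KP y : y \in slit_support -> K y = K (e 0).
  by case/slit_supportP=> i ik /(slitV_inv Kt ik)->; apply: KV.
have [xP|xP] := boolP (x \in slit_support); first by rewrite !KP // slit_taut_support.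
by rewrite slit_taut_off.
Qed.

End SlitTheory.

(** * Shaded maps and lightest geodesics *)

Lemma reverseK : involutive reverse. Proof. by case. Qed.

Lemma uniq_flatten_mem (T : eqType) (ls : seq (seq T)) f : uniq (flatten ls) ->
  f \in ls -> uniq f.
Proof.
elim: ls => //= g ls IHls; rewrite cat_uniq inE => /and3P[ug _ uls].
by case/predU1P=> [-> //|]; apply: IHls.
Qed.

Section Faces.

Variable m : shaded_map.
Implicit Types (o : orientation) (x y : edge m).

Definition faces_ok := perm_eq (flatten (light m)) (enum (edge m)).

Lemma light_faceE f x : uniq (flatten (light m)) -> f \in light m -> x \in f ->
  light_face x = f.
Proof.
rewrite /light_face; elim: (light m) => //= g ls IHls.
rewrite cat_uniq inE => /and3P[ug /hasPn gls uls] /predU1P[-> ->//|fls] xf.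
have [xg|xg] := boolP (x \in g); last exact: IHls.
have /gls/= : x \in flatten ls by apply/flattenP; exists f.
by rewrite xg.
Qed.

Hypothesis ok : faces_ok.

Lemma faces_uniq : uniq (flatten (light m)).
Proof. by rewrite (perm_uniq ok) enum_uniq. Qed.

Lemma mem_light_face x : light_face x \in light m /\ x \in light_face x.
Proof.
have /flattenP[f fm xf] : x \in flatten (light m) by rewrite (perm_mem ok) mem_enum.
by rewrite (light_faceE faces_uniq fm xf).
Qed.

Lemma light_face_uniq x : uniq (light_face x).
Proof. by have [fm _] := mem_light_face x; apply: uniq_flatten_mem fm; apply: faces_uniq. Qed.

Lemma light_step_next f x : f \in light m -> x \in f -> light_step LightLeft x = next f x.
Proof. by move=> fm xf; rewrite /= (light_faceE faces_uniq fm xf). Qed.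

Lemma light_stepK o : cancel (@light_step m o) (light_step (reverse o)).
Proof.
move=> x; have [fm xf] := mem_light_face x; have uf := light_face_uniq x.
case: o => /=.
  have -> : light_face (next (light_face x) x) = light_face x.
    by apply: (light_faceE faces_uniq fm); rewrite mem_next.
  exact: prev_next.
have -> : light_face (prev (light_face x) x) = light_face x.
  by apply: (light_faceE faces_uniq fm); rewrite mem_prev.
exact: next_prev.
Qed.

Lemma light_stepVK o : cancel (@light_step m (reverse o)) (light_step o).
Proof. by move=> x; rewrite -{1}[o]reverseK light_stepK. Qed.

Lemma dark_stepK o : cancel (@dark_step m o) (dark_step (reverse o)).
Proof. by case: o => x /=; [apply: permK | apply: permKV]. Qed.

Lemma turn_dark o x : turn o (dark_step o x) = light_step o x.
Proof. by rewrite /turn dark_stepK. Qed.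

Lemma light_turn o x : light_step o (turn (reverse o) x) = dark_step o x.
Proof. by rewrite /turn light_stepVK reverseK. Qed.

Lemma turn_inj o : injective (@turn m o).
Proof.
apply: inj_comp; first exact: can_inj (light_stepK o).
by apply: can_inj (dark_stepK (reverse o)).
Qed.

(** A dark step carries the edges that end at a vertex to those that start there, and reverses the
    sense of rotation. *)
Lemma turn_revE o n x y :
  iter n (turn (reverse o)) x = y <->
  iter n (turn o) (dark_step o y) = dark_step o x.
Proof.
have revK (u : edge m) : turn o (dark_step o (turn (reverse o) u)) = dark_step o u.
  by rewrite turn_dark light_turn.
elim: n x y => [|n IHn] x y; first by split=> /= [->|/(can_inj (dark_stepK o))].
rewrite iterSr iterS; split=> [/IHn->|tE]; first exact: revK.
by apply/IHn; apply: (@turn_inj o); rewrite revK.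
Qed.

Lemma left_origin_eq x y :
  left_origin x = left_origin y <-> fconnect (turn LightLeft) x y.
Proof.
have sym := fconnect_sym (@turn_inj LightLeft); split=> [xy|xy].
  have : y \in left_origin x by rewrite xy inE.
  by rewrite inE.
by apply/setP=> w; rewrite !inE (same_connect sym xy).
Qed.

Lemma origin_eq o x y : origin o x = origin o y <-> fconnect (turn o) x y.
Proof.
case: o; first exact: left_origin_eq.
have E n : iter n (turn LightRight) x = y <->
    iter n (turn LightLeft) (light_step LightLeft y) = light_step LightLeft x.
  rewrite -!turn_dark -iterSr iterS.
  by split=> [/(@turn_revE LightLeft)->|/turn_inj/(@turn_revE LightLeft)].
have sym := fconnect_sym (@turn_inj LightLeft).
rewrite /origin; split=> [/left_origin_eq|/iter_findex/E <-].
  by rewrite sym => /iter_findex/E <-; apply: fconnect_iter.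
by apply/left_origin_eq; rewrite sym fconnect_iter.
Qed.

Lemma origin_turn o x : origin o (turn o x) = origin o x.
Proof. by apply/origin_eq; rewrite fconnect_sym ?fconnect1 //; apply: turn_inj. Qed.

Lemma origin_iter_turn o n x : origin o (iter n (turn o) x) = origin o x.
Proof. by elim: n => //= n <-; rewrite origin_turn. Qed.

Lemma target_light o x : target o x = origin o (light_step o x).
Proof. by case: o; rewrite // /target /origin (light_stepVK LightLeft). Qed.

Lemma target_dark o x : target o x = origin o (dark_step o x).
Proof. by rewrite target_light -turn_dark origin_turn. Qed.

Lemma verticesE o : vertices m = [set origin o x | x in [set: edge m]].
Proof.
apply/setP=> u; apply/imsetP/imsetP => [[x _ ->]|[x _ ->]].
  case: o; first by exists x.
  by exists (light_step LightRight x); rewrite // /origin (light_stepVK LightLeft).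
by case: o; [exists x | exists (light_step LightLeft x)].
Qed.

Lemma origin_vertex o x : origin o x \in vertices m.
Proof. by rewrite (verticesE o) imset_f. Qed.

Lemma adjacent_step o x : adjacent (origin o x) (target o x).
Proof. by apply/existsP; exists x; case: o; rewrite !eqxx ?orbT. Qed.

Lemma adjacent_sym : symmetric (@adjacent m).
Proof. by move=> u w; apply/eq_existsb => x; rewrite orbC. Qed.

Lemma adjacentP o u w : adjacent u w -> exists x,
  (u = origin o x /\ w = target o x) \/ (w = origin o x /\ u = target o x).
Proof.
case/existsP=> x; case: o => h; exists x; case/orP: h => /andP[/eqP-> /eqP->];
  by [left | right].
Qed.

(** * Connectedness, oriented paths and distances *)

Definition connected_map := {in vertices m &, forall u w, connect (@adjacent m) u w}.

(** A turn stays at the origin of an edge and a dark step moves to its end, so invariance under both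
    is invariance along adjacency. *)
Lemma connected_bitransitive o :
  connected_map <-> bitransitive (@dark_step m o) (@turn m o).
Proof.
split=> [conn K Kd Kt x y|tr u w].
  have Ko u v : origin o u = origin o v -> K u = K v.
    move/origin_eq/iter_findex <-.
    by elim: (findex _ _ _) => //= n ->; rewrite Kt.
  have /connectP[p] := conn _ _ (origin_vertex o x) (origin_vertex o y).
  elim: p x => [|u p IHp] x /=; first by move=> _ /esym; apply: Ko.
  case/andP=> /(adjacentP o)[w [] [xE uE]] pp lp.
    rewrite (Ko _ _ xE) -Kd; move: pp lp; rewrite uE target_dark; exact: IHp.
  rewrite target_dark in uE; rewrite (Ko _ _ uE) Kd; move: pp lp.
  by rewrite xE; apply: IHp.
rewrite (verticesE o) => /imsetP[x _ ->] /imsetP[y _ ->].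
pose K y := connect (@adjacent m) (origin o x) (origin o y).
have sym := sym_connect_sym adjacent_sym.
suff : K x = K y by rewrite /K connect0 => <-.
apply: tr => t; last by rewrite /K origin_turn.
rewrite /K !(sym (origin o x)); apply: same_connect => //.
by rewrite sym connect1 // -target_dark adjacent_step.
Qed.

Lemma is_path_rcons o (u : {set edge m}) s x w :
  is_path o u (rcons s x) w = is_path o u s (origin o x) && (target o x == w).
Proof.
elim: s u => [|y s IHs] u /=; first by rewrite eq_sym.
by rewrite IHs andbA.
Qed.

Lemma is_path_rev o (u : {set edge m}) s w :
  is_path o u s w = is_path (reverse o) w (rev s) u.
Proof.
elim: s u => [|x s IHs] u /=; first by rewrite eq_sym.
by rewrite rev_cons is_path_rcons IHs andbC /target reverseK.
Qed.

Lemma is_dist_rev o (u w : {set edge m}) n :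
  is_dist o u w n -> is_dist (reverse o) w u n.
Proof.
case=> -[s sp sn] smin; split; first by exists (rev s); rewrite ?size_rev -?is_path_rev.
by move=> t tp; rewrite -size_rev; apply: smin; rewrite is_path_rev revK.
Qed.

Lemma leaving_rev o (v : {set edge m}) x : leaving (reverse o) v x <-> approaching o v x.
Proof.
split=> -[n [d1 d2]]; exists n.
  by move: (is_dist_rev d1) (is_dist_rev d2); rewrite /target !reverseK.
by move: (is_dist_rev d1) (is_dist_rev d2); rewrite /target reverseK.
Qed.

Lemma is_dist_uniq o (u w : {set edge m}) n n' :
  is_dist o u w n -> is_dist o u w n' -> n = n'.
Proof.
case=> -[s sp <-] smin [[t tp <-] tmin].
by apply/eqP; rewrite eqn_leq smin // tmin.
Qed.

Definition strongly_connected o :=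
  forall x y : edge m, exists s, is_path o (origin o x) s (origin o y).

(** Reachability clearly propagates along a dark step. It also propagates backwards, since the
    contour of a dark face is an oriented cycle that leads back to the edge. *)
Lemma bitransitive_strongly_connected o :
  bitransitive (@dark_step m o) (@turn m o) -> strongly_connected o.
Proof.
move=> tr x y.
pose st := [rel u w : {set edge m} | [exists x, (origin o x == u) && (target o x == w)]].
have st_dark w : st (origin o w) (origin o (dark_step o w)).
  by apply/existsP; exists w; rewrite target_dark !eqxx.
pose K y := connect st (origin o x) (origin o y).
have : K x = K y.
  apply: tr => w; last by rewrite /K origin_turn.
  apply/idP/idP => h; last by apply: connect_trans h (connect1 (st_dark w)).
  apply: connect_trans h _; have inj := can_inj (dark_stepK o).
  have : fconnect (dark_step o) (dark_step o w) w by rewrite fconnect_sym ?fconnect1.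
  move/iter_findex=> {2}<-; elim: (findex _ _ _) => [|n IHn]; first exact: connect0.
  by apply: connect_trans IHn (connect1 (st_dark _)).
rewrite /K connect0 => /esym/connectP[p].
elim: p (origin o x) => [|w p IHp] u /=; first by move=> _ ->; exists [::] => /=.
case/andP=> /existsP[t /andP[/eqP tu /eqP tw]] pp lp.
have [s sp] := IHp w pp lp; exists (t :: s) => /=.
by rewrite tu eqxx tw.
Qed.

Lemma dist_exists o (v : {set edge m}) :
  (forall x, exists s, is_path o (origin o x) s v) ->
  exists l : edge m -> nat, forall x, is_dist o (origin o x) v (l x).
Proof.
move=> conn; apply: (@fin_all_exists (edge m) (fun=> nat)
  (fun x n => is_dist o (origin o x) v n)) => x.
(* With tuples, the existence of a path of a given length is decidable, so a minimum can be
   taken. *)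
pose P n := [exists t : n.-tuple (edge m), is_path o (origin o x) t v].
have exP : exists n, P n.
  by have [s sp] := conn x; exists (size s); apply/existsP; exists (in_tuple s).
case: (ex_minnP exP) => n /existsP[t tp] nmin; exists n; split.
  by exists t; rewrite ?size_tuple.
by move=> s sp; apply: nmin; apply/existsP; exists (in_tuple s).
Qed.

Section Distance.

Variables (o : orientation) (v : {set edge m}) (l : edge m -> nat).
Hypothesis lP : forall x, is_dist o (origin o x) v (l x).

Lemma dist_origin x y : origin o x = origin o y -> l x = l y.
Proof. by move=> xy; apply: is_dist_uniq (lP x) _; rewrite xy. Qed.

Lemma dist_turn x : l (turn o x) = l x.
Proof. by apply: dist_origin; apply: origin_turn. Qed.

Lemma dist_light x : l (light_step o x) = l (dark_step o x).
Proof. by rewrite -turn_dark dist_turn. Qed.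

Lemma dist_dark x : l x <= (l (dark_step o x)).+1.
Proof.
have [_ h] := lP x; have [[s sp <-] _] := lP (dark_step o x).
by apply: (h (x :: s)); rewrite /= eqxx target_dark.
Qed.

Lemma dist_eq0 x : l x = 0 <-> origin o x = v.
Proof.
split=> [l0|xv]; first by have [[[|? ?] /= /eqP //]] := lP x; rewrite l0.
have [_ /(_ [::])] := lP x; rewrite /= xv eqxx leqn0.
by move=> /(_ isT)/eqP.
Qed.

Lemma approachingE x : approaching o v x <-> l x = (l (dark_step o x)).+1.
Proof.
split=> [[n [d1 d2]]|xE].
  rewrite (is_dist_uniq (lP x) d1); congr _.+1; apply: is_dist_uniq d2 _.
  by rewrite target_dark; apply: lP.
exists (l (dark_step o x)); split; first by rewrite -xE; apply: lP.
by rewrite target_dark; apply: lP.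
Qed.

End Distance.

(** Each edge lowers [g] by at most one, so a path is at least as long as the drop of [g]. Lower
    bounds for distances in one map thus come from a function built on the distances in the
    other. *)
Lemma potential_path o (g : edge m -> nat) x s y :
  (forall x, g (turn o x) = g x) -> (forall x, g x <= (g (dark_step o x)).+1) ->
  is_path o (origin o x) s (origin o y) -> g x <= g y + size s.
Proof.
move=> gt gd; have go u w : origin o u = origin o w -> g u = g w.
  move/origin_eq/iter_findex <-.
  by elim: (findex _ _ _) => //= n ->; rewrite gt.
elim: s x => [|w s IHs] x /=; first by move/eqP/go->; rewrite addn0.
case/andP=> /eqP/go <-; rewrite target_dark => /IHs h.
by apply: leq_trans (gd w) _; rewrite addnS ltnS.
Qed.

Lemma copotential_path o (g : edge m -> nat) x s y :
  (forall x, g (turn o x) = g x) -> (forall x, g (dark_step o x) <= (g x).+1) ->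
  is_path o (origin o x) s (origin o y) -> g y <= g x + size s.
Proof.
move=> gt gd; have go u w : origin o u = origin o w -> g u = g w.
  move/origin_eq/iter_findex <-.
  by elim: (findex _ _ _) => //= n ->; rewrite gt.
elim: s x => [|w s IHs] x /=; first by move/eqP/go->; rewrite addn0.
case/andP=> /eqP/go <-; rewrite target_dark => /IHs h.
by apply: leq_trans h _; rewrite addnS -addSn leq_add2r.
Qed.

(** * Existence, uniqueness and simplicity of lightest geodesics *)

Section Lightest.

Variables (o : orientation) (v : {set edge m}).

Lemma lightest_det x s s' :
  lightest_geodesic o v x s -> lightest_geodesic o v x s' -> s = s'.
Proof.
move=> h; elim: h s' => {x s} [x xv|x j s xv ap nap _ IHs] s' h'.
  by inversion h'.
inversion h' as [|? j' s2 ? ap' nap' h2]; subst => //.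
have jj' : j = j'.
  by case: (ltngtP j j') => // jj'; [case: (nap' _ jj')|case: (nap _ jj')].
by rewrite -jj' in h2 *; rewrite (IHs _ h2).
Qed.

Definition first_approaching x y := exists j,
  [/\ y = iter j (turn o) x, approaching o v y
    & forall i, i < j -> ~ approaching o v (iter i (turn o) x)].

(** Pointwise form of the greedy recursion, in which reversing the path is a mere change of
    index. *)
Lemma lightest_nthP d x s : lightest_geodesic o v x s <->
  (forall i, i < size s ->
     let y := nth d (x :: map (light_step o) s) i in
     origin o y <> v /\ first_approaching y (nth d s i))
  /\ origin o (last x (map (light_step o) s)) = v.
Proof.
split=> [h|].
  elim: h => {x s} [x xv|x j s xv ap nap _ [IHs ls]]; first by split.
  split=> // -[_|i ik] /=; last exact: IHs.
  by split=> //; exists j.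
elim: s x => [|y s IHs] x [h ls]; first by apply: Lightest_end.
have [/= xv [j [yE ap nap]]] := h 0 isT.
rewrite yE; apply: Lightest_step => //; first by rewrite -yE.
by rewrite -yE; apply: IHs; split=> // i ik; apply: (h i.+1).
Qed.

Hypothesis conn : forall x, exists s, is_path o (origin o x) s v.

Lemma lightest_exists x : exists s, lightest_geodesic o v x s.
Proof.
have [l lP] := dist_exists conn; have [n] := ubnP (l x).
elim: n x => // n IHn x; rewrite ltnS => ln.
have [[|y s] /= sp] := (lP x).1.
  by move=> _; exists [::]; apply: Lightest_end; apply/eqP.
case/andP: sp => /eqP yx sp sl.
have xv : origin o x <> v by move/(dist_eq0 lP) => l0; rewrite l0 in sl.
(* The first edge of a shortest path starts at the same vertex, hence is met while turning: the
   search terminates. *)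
have exj : exists j, l (iter j (turn o) x) == (l (dark_step o (iter j (turn o) x))).+1.
  have /esym/origin_eq/iter_findex yE := yx; exists (findex (turn o) x y).
  rewrite yE eqn_leq (dist_dark lP) /= (dist_origin lP yx) -sl ltnS.
  by have [_] := lP (dark_step o y); apply; rewrite -target_dark.
case: (ex_minnP exj) => j /eqP jE jmin.
have lj : l (iter j (turn o) x) = l x.
  by elim: (j) => //= i <-; rewrite (dist_turn lP).
have [t tP] : exists t, lightest_geodesic o v (light_step o (iter j (turn o) x)) t.
  by apply: IHn; rewrite (dist_light lP) -jE lj.
exists (iter j (turn o) x :: t); apply: Lightest_step => //.
  exact/(approachingE lP).
move=> i ij /(approachingE lP)/eqP/jmin; rewrite leqNgt ij.
by [].
Qed.

(** The distance to [v] drops by exactly one along each chosen edge, which gives minimality and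
    forbids revisiting a vertex. *)
Lemma lightest_dist x s : lightest_geodesic o v x s ->
  [/\ is_dist o (origin o x) v (size s), is_path o (origin o x) s v
    & is_simple_path o (origin o x) s v].
Proof.
have [l lP] := dist_exists conn.
have lI i y : l (iter i (turn o) y) = l y.
  by apply: (dist_origin lP); apply: origin_iter_turn.
move=> h; suff [ls sp us lt] : [/\ l x = size s, is_path o (origin o x) s v,
    uniq (origin o x :: map (target o) s)
    & forall w, w \in map (target o) s -> exists2 y, w = origin o y & l y < size s].
  by split; rewrite // ?/is_simple_path ?sp // -ls; apply: lP.
elim: h => {x s} [x xv|x j s xv ap nap _ [ls sp us lt]].
  by split=> //=; [apply/(dist_eq0 lP)|rewrite xv].
have /(approachingE lP) := ap; rewrite lI -(dist_light lP) ls => lx.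
have lt' w : w \in map (target o) (iter j (turn o) x :: s) ->
    exists2 y, w = origin o y & l y < (size s).+1.
  rewrite inE => /predU1P[->|/lt[y yE yl]]; last by exists y; rewrite // ltnW.
  by exists (light_step o (iter j (turn o) x)); rewrite ?target_light ?ls.
split=> //.
- by rewrite /= origin_iter_turn eqxx target_light.
- apply/andP; split; last by rewrite /= target_light.
  by apply/negP=> /lt'[y yE]; rewrite -(dist_origin lP yE) lx ltnn.
Qed.

End Lightest.
End Faces.

(** * Sliding *)

Section FullSlide.

Variables (T : eqType) (d0 : T) (s : seq T).
Local Notation k := (size s).
Local Notation e := (nth d0 (d0 :: s)).

(* The whole cycle (e_k ... e_1 d0): unlike [slide d0 s], it also moves [d0]. *)
Definition full_slide x := if x == d0 then last d0 s else slide d0 s x.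

Lemma slideE x : x != d0 -> slide d0 s x = full_slide x.
Proof. by rewrite /full_slide => /negPf->. Qed.

Lemma nth_size_last : e k = last d0 s. Proof. by rewrite -last_nth. Qed.

Lemma full_slide_d0 : full_slide d0 = last d0 s.
Proof. by rewrite /full_slide eqxx. Qed.

Lemma full_slide0 : full_slide (e 0) = e k.
Proof. by rewrite nth_size_last full_slide_d0. Qed.

Lemma full_slideN x : (forall i, i <= k -> x <> e i) -> full_slide x = x.
Proof.
move=> off; rewrite /full_slide /slide ifN; last by apply/eqP; apply: (off 0).
rewrite ifN //; apply/negP=> xs; apply: (off (index x s).+1); first by rewrite index_mem.
by rewrite /= nth_index.
Qed.

Hypothesis us : uniq (d0 :: s).

Lemma path_nth_inj i j : i <= k -> j <= k -> e i = e j -> i = j.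
Proof. by move=> ik jk /eqP; rewrite nth_uniq // => /eqP. Qed.

Lemma full_slideS i : i < k -> full_slide (e i.+1) = e i.
Proof.
move=> ik; have es : e i.+1 \in s by rewrite /= mem_nth.
have /= /andP[ds us'] := us; rewrite /full_slide /slide es ifN.
  by rewrite /= index_uniq.
by apply: contraNneq ds => <-.
Qed.

Lemma mem_path_nthP x :
  (exists2 i, i <= k & x = e i) \/ (forall i, i <= k -> x <> e i).
Proof.
have [/(nthP d0)[i ik <-]|xs] := boolP (x \in d0 :: s); first by left; exists i.
by right=> i ik xi; rewrite xi mem_nth in xs.
Qed.

Variables (e1 : T) (s' : seq T).
Hypothesis revE : rev (d0 :: s) = e1 :: s'.

Lemma rev_path_size : size s' = k.
Proof. by have := congr1 size revE; rewrite size_rev => -[]. Qed.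

Lemma rev_path_nth i : i <= k -> nth e1 (e1 :: s') i = e (k - i).
Proof.
move=> ik; rewrite -revE nth_rev //= subSS.
by apply: set_nth_default; rewrite ltnS leq_subr.
Qed.

Lemma rev_path_uniq : uniq (e1 :: s').
Proof. by rewrite -revE rev_uniq. Qed.

Lemma rev_path_last : last d0 s = e1 /\ last e1 s' = d0.
Proof.
have h0 := rev_path_nth (leq0n k); have hk := rev_path_nth (leqnn k).
split; first by rewrite -nth_size_last -[k]subn0 -h0.
by rewrite (last_nth e1) rev_path_size hk subnn.
Qed.

End FullSlide.

(** The reversed list describes the inverse cyclic permutation. *)
Lemma full_slide_rev (T : eqType) (d0 e1 : T) (s s' : seq T) x :
  uniq (d0 :: s) -> rev (d0 :: s) = e1 :: s' ->
  full_slide e1 s' (full_slide d0 s x) = x.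
Proof.
move=> us revE; have us' := rev_path_uniq us revE; have sz := rev_path_size revE.
have [ld ld'] := rev_path_last revE.
case: (mem_path_nthP d0 s x) => [[[|i] ik ->]|off].
- by rewrite full_slide0 nth_size_last ld full_slide_d0.
- rewrite full_slideS // -[i in LHS](subKn (ltnW ik)) -(rev_path_nth revE) ?leq_subr //.
  rewrite -(subnSK ik) full_slideS ?sz ?ltn_subrL ?(leq_ltn_trans _ ik) //.
  by rewrite (rev_path_nth revE) ?leq_subr // subKn.
rewrite (full_slideN off) full_slideN // => i; rewrite sz => ik.
by rewrite (rev_path_nth revE ik); apply: off; apply: leq_subr.
Qed.

Lemma rev_swap (T : Type) (d0 e1 : T) (s s' : seq T) :
  rev (d0 :: s) = e1 :: s' -> rev (e1 :: s') = d0 :: s.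
Proof. by move<-; rewrite revK. Qed.

Lemma rev_consE (T : Type) (x : T) (s : seq T) :
  exists d0 t, rev (x :: s) = d0 :: t.
Proof. by case E: (rev (x :: s)) => [|d0 t]; [have := size_rev (x :: s); rewrite E|exists d0, t]. Qed.

Lemma full_slide_inj (T : eqType) (d0 : T) (s : seq T) :
  uniq (d0 :: s) -> injective (full_slide d0 s).
Proof.
move=> us; have [e1 [s' revE]] := rev_consE d0 s.
by apply: can_inj (full_slide e1 s') _ => x; apply: full_slide_rev.
Qed.

Lemma slide_rev (T : eqType) (d0 e1 : T) (s s' : seq T) x :
  uniq (d0 :: s) -> rev (d0 :: s) = e1 :: s' -> x != d0 ->
  slide e1 s' (slide d0 s x) = x.
Proof.
move=> us revE xd; rewrite !slideE ?full_slide_rev //.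
have [<- _] := rev_path_last revE.
by rewrite -full_slide_d0 (inj_eq (full_slide_inj us)).
Qed.

(** * Two maps related by a slide *)

Section SlideMaps.

Variables (m : shaded_map) (lt : seq (seq (edge m))) (o : orientation).
Variables (d0 z : edge m) (s : seq (edge m)).
Local Notation mt := (ShadedMap lt (dark m)).
Local Notation E := (edge m).
Local Notation L := (@light_step m o).
Local Notation Lt := (@light_step mt o : E -> E).
Local Notation LtV := (@light_step mt (reverse o) : E -> E).
Local Notation tau := (@turn m o).
Local Notation taut := (@turn mt o : E -> E).
Local Notation tautV := (@turn mt (reverse o) : E -> E).
Local Notation dk := (@dark_step m o).
Local Notation orig := (@origin m o).
Local Notation origt := (@origin mt o : E -> {set E}).
Local Notation k := (size s).
Local Notation e := (nth d0 (d0 :: s)).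
Local Notation vt := (origt d0).
Local Notation v := (orig (L z)).
Local Notation sg := (full_slide d0 s).
Local Notation slit' := (slit L tau taut dk k e z).

(** [Lt] is [L] conjugated by [sg], except that the loop [d0], renamed [last d0 s], is inserted
    after [z], the edge before the exit corner. Nothing here says which of the two maps was given
    first. *)
Record slides_to : Prop := SlidesTo {
  slides_loop : L d0 = d0;
  slides_z : z <> d0;
  slides_N x : x <> d0 -> x <> z -> Lt (sg x) = sg (L x);
  slides_in : Lt (sg z) = last d0 s;
  slides_out : Lt (last d0 s) = sg (L z)
}.

Hypotheses (ok : faces_ok m) (okt : faces_ok mt) (st : slides_to).
Hypothesis us : uniq (d0 :: s).

Lemma maps_injL : injective L. Proof. exact: can_inj (light_stepK ok o). Qed.
Lemma maps_injdk : injective dk. Proof. exact: can_inj (@dark_stepK m o). Qed.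
Lemma maps_inj_tau : injective tau. Proof. exact: turn_inj. Qed.
Lemma maps_inj_taut : injective taut. Proof. exact: (turn_inj okt). Qed.
Lemma maps_tauE x : tau (dk x) = L x. Proof. exact: turn_dark. Qed.
Lemma maps_tautE x : taut (dk x) = Lt x. Proof. exact: (@turn_dark mt). Qed.
Lemma maps_origt_taut x : origt (taut x) = origt x. Proof. exact: (origin_turn okt). Qed.
Lemma maps_targett_dark x : @target mt o x = origt (dk x).
Proof. exact: (target_dark okt). Qed.
Lemma maps_ek : e k = last d0 s. Proof. exact: nth_size_last. Qed.

Lemma maps_tautV_E n x y : iter n tautV x = y <-> iter n taut (dk y) = dk x.
Proof. exact: (turn_revE okt). Qed.

(** Translates the search of the reversed geodesic into ordinary turns that arrive at [y]; the
    additional turn accounts for the light step from [y]. *)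
Lemma maps_tautV_light n x y : iter n tautV (LtV y) = x <-> iter n.+1 taut (dk x) = y.
Proof.
have K : taut (dk (LtV y)) = y by rewrite maps_tautE; apply: (light_stepVK okt).
split=> [/maps_tautV_E nE|nE]; first by rewrite iterS nE K.
by apply/maps_tautV_E; apply: maps_inj_taut; rewrite K.
Qed.

Lemma maps_slit_fromV :
  (forall i, i <= k -> fconnect tau (L (e i)) (block_head L k e z i)) ->
  (forall i j, i <= k -> j <= k -> fconnect tau (L (e i)) (L (e j)) -> i = j) ->
  exists A B, slit' A B.
Proof.
move=> h1 h2; apply: (@slit_fromV _ L Lt tau taut dk k e z sg) => //.
- exact: maps_injL.
- exact: maps_injdk.
- exact: maps_inj_tau.
- exact: maps_tauE.
- exact: maps_tautE.
- exact: path_nth_inj.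
- exact: slides_loop st.
- exact: slides_z st.
- exact: full_slideS.
- exact: full_slideN.
- exact: slides_N st.
- by rewrite maps_ek; apply: slides_in st.
- by rewrite maps_ek; apply: slides_out st.
Qed.

Lemma maps_slit_fromW :
  (forall i, i < k -> fconnect taut (Lt (e i)) (e i.+1)) ->
  (forall i j, i <= k.+1 -> j <= k.+1 ->
    fconnect taut (if i is i'.+1 then Lt (e i') else e 0)
                  (if j is j'.+1 then Lt (e j') else e 0) -> i = j) ->
  exists A B, slit' A B.
Proof.
move=> h1 h2; apply: (@slit_fromW _ L Lt tau taut dk k e z sg) => //.
- exact: maps_injL.
- exact: maps_injdk.
- exact: maps_inj_taut.
- exact: maps_tauE.
- exact: maps_tautE.
- exact: path_nth_inj.
- exact: slides_loop st.
- exact: slides_z st.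
- exact: full_slideS.
- exact: full_slide0.
- exact: full_slideN.
- exact: slides_N st.
- by rewrite maps_ek; apply: slides_in st.
- by rewrite maps_ek; apply: slides_out st.
Qed.

Lemma nth_light i : i <= k -> nth d0 (d0 :: map L s) i = L (e i).
Proof.
case: i => [_|i ik] /=; first by rewrite (slides_loop st).
exact: nth_map.
Qed.

Lemma last_light : last d0 (map L s) = L (e k).
Proof. by rewrite -nth_light // (last_nth d0) size_map. Qed.

Lemma lightestV_nthP : lightest_geodesic o v d0 s <->
  (forall i, i < k -> orig (L (e i)) <> v /\ first_approaching o v (L (e i)) (e i.+1))
  /\ orig (L (e k)) = v.
Proof.
split=> [/(lightest_nthP _ _ d0)[h lE]|[h lE]].
  split=> [i ik|]; last by rewrite last_light in lE.
  by have := h i ik; rewrite (nth_light (ltnW ik)).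
apply/(lightest_nthP _ _ d0); split=> [i ik|]; last by rewrite last_light.
by rewrite (nth_light (ltnW ik)); apply: h.
Qed.

(** * From the lightest geodesic of the old map to that of the slid map *)

Section Forward.

Hypotheses (tr : bitransitive dk tau) (lg : lightest_geodesic o v d0 s).

Lemma forward_conn x : exists t, is_path o (orig x) t v.
Proof. exact: bitransitive_strongly_connected. Qed.

Section Dist.

Variable l : E -> nat.
Hypothesis lP : forall x, is_dist o (orig x) v (l x).

Lemma forward_dist i : i <= k -> l (L (e i)) = k - i.
Proof.
have [h lE] := lightestV_nthP.1 lg.
suff H n : n <= k -> l (L (e (k - n))) = n by move=> ik; rewrite -{1}(subKn ik) H ?leq_subr.
elim: n => [_|n IHn nk]; first by rewrite subn0; apply/(dist_eq0 lP).
have nS : k - n = (k - n.+1).+1 by rewrite subnSK.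
have nk' : k - n.+1 < k by rewrite ltn_subrL (leq_ltn_trans _ nk).
have [_ [j [jE ap _]]] := h _ nk'; rewrite nS in IHn.
have le : l (L (e (k - n.+1))) = l (e (k - n.+1).+1).
  by rewrite jE; symmetry; apply: (dist_origin lP); apply: origin_iter_turn.
by rewrite le ((approachingE ok lP _).1 ap) -(dist_light ok lP) IHn // ltnW.
Qed.

(** The vertices of the path are distinct because their distances to [v] are. *)
Lemma forward_slit : exists A B, slit' A B.
Proof.
have [h lE] := lightestV_nthP.1 lg.
apply: maps_slit_fromV => [i|i j ik jk ij].
  rewrite leq_eqVlt /block_head => /predU1P[->|ik].
    by rewrite ltnn; apply/origin_eq.
  by rewrite ik; have [_ [j [-> _ _]]] := h i ik; apply: fconnect_iter.
move/(origin_eq ok)/(dist_origin lP): ij; rewrite !forward_dist // => /eqP.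
by rewrite eqn_sub2lE // => /eqP.
Qed.

Section WithSlit.

Variables (A B : nat -> seq E).
Hypothesis S : slit' A B.

Let l_dk i : i <= k -> l (dk (e i)) = k - i.
Proof. by move=> ik; rewrite -(dist_light ok lP) forward_dist. Qed.

Let l_tau x : l (tau x) = l x. Proof. exact: dist_turn. Qed.

(** The search meets the edges of [A i] strictly before [e i.+1] and rejects them; at the last
    vertex [l] is already 0. *)
Lemma forward_lside x : lside k A x -> l x <= l (dk x).
Proof.
have [h lE] := lightestV_nthP.1 lg.
case/lsideP=> i; rewrite leq_eqVlt => /predU1P[->|ik] xi.
  by rewrite (slitV_inv S l_tau (leqnn k)) ?mem_cat ?xi // l_dk // subnn.
have [n nA nE] := slit_run_V S (ltnW ik) xi.
have [_ [j [jE _ nap]]] := h i ik.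
have nj : n < j.
  apply: leq_trans nA _; rewrite leqNgt; apply/negP=> jA.
  apply: (slitAB S (ltnW ik) (ltnW ik) _ (slit_path_mem_B S ik)).
  by have := slit_run_V_mem S (ltnW ik) jA; rewrite -jE.
have := nap n nj; rewrite nE => nap'.
have := dist_dark ok lP x; rewrite leq_eqVlt => /predU1P[/(approachingE ok lP)//|].
by rewrite ltnS.
Qed.

Let g x := l x + lside k A x.

Let g_taut x : g (taut x) = g x.
Proof. by apply: (forward_potential_inv S maps_inj_tau l_tau l_dk). Qed.

(** Stronger than [g_dk]: the right-hand side has [l], not [g]. This spares one unit when [dk x] is
    on the light side, which [forward_first] requires. *)
Let g_le x : g x <= (l (dk x)).+1.
Proof.
rewrite /g; case: (boolP (lside k A x)) => [/forward_lside lx|_].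
  by rewrite addn1 ltnS.
by rewrite addn0; apply: dist_dark.
Qed.

Let g_dk x : g x <= (g (dk x)).+1.
Proof. by apply: leq_trans (g_le x) _; rewrite ltnS leq_addr. Qed.

Let g0 : g d0 = k.+1.
Proof. exact: (forward_potential_W0 S l_tau l_dk (slitA0 S)). Qed.

Let gW i : i <= k -> g (dk (e i)) = k - i.
Proof.
move=> ik; apply: (forward_potential_W S l_tau l_dk ik).
by rewrite mem_cat (slit_dark_mem_B S ik) orbT.
Qed.

Lemma slit_origt i : i < k -> origt (e i.+1) = origt (dk (e i)).
Proof.
move=> ik; apply: (slitW_inv S maps_origt_taut (ltnW ik)).
by rewrite mem_cat (slit_path_mem_B S ik) orbT.
Qed.

Lemma slit_patht i : i <= k -> @is_path mt o vt (take i.+1 (d0 :: s)) (origt (dk (e i))).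
Proof.
elim: i => [_|i IHi ik]; first by rewrite /= take0 /= eqxx maps_targett_dark eqxx.
rewrite (take_nth d0) // (@is_path_rcons mt) maps_targett_dark eqxx andbT.
by rewrite slit_origt // IHi // ltnW.
Qed.

(** The slid path gives the upper bound; the drop of [g] from [k.+1] to [k - i] gives the lower
    one. *)
Lemma forward_distW i : i <= k -> @is_dist mt o vt (origt (dk (e i))) i.+1.
Proof.
move=> ik; split; first by exists (take i.+1 (d0 :: s)); rewrite ?slit_patht // size_takel.
move=> t tp; have := @potential_path mt okt o g d0 t (dk (e i)) g_taut g_dk tp.
rewrite g0 gW //.
by rewrite -leq_subLR subSn ?leq_subr // subKn.
Qed.

Lemma forward_dist_origin i : i <= k -> @is_dist mt o vt (origt (e i)) i.
Proof.
case: i => [_|i ik]; last by rewrite slit_origt //; apply/forward_distW/ltnW.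
by split=> //; exists [::] => //=.
Qed.

Lemma forward_approaching i : i <= k -> @approaching mt (reverse o) vt (e i).
Proof.
move=> ik; apply/leaving_rev; rewrite reverseK; exists i.
by rewrite maps_targett_dark; split; [apply: forward_dist_origin|apply: forward_distW].
Qed.

Lemma forward_first i : i < k ->
  @first_approaching mt (reverse o) vt (LtV (e i.+1)) (e i).
Proof.
move=> ik; exists (size (A i.+1)); split.
- by symmetry; apply/maps_tautV_light; apply: (slit_run_W_size S ik).
- exact/forward_approaching/ltnW.
move=> n nA; set x := iter n _ _.
have xE : iter n.+1 taut (dk x) = e i.+1 by apply/maps_tautV_light.
have [a aA aE] := slit_run_W_mem S ik nA.
have ax : dk x = a.
  move: xE; rewrite -aE; elim: (n.+1) => //= n' IHn /maps_inj_taut; exact: IHn.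
move/leaving_rev; rewrite reverseK => -[n0 [d1 d2]].
have xW : dk x \in A i.+1 ++ B i by rewrite ax mem_cat aA.
have [n0i] : n0.+1 = i.+1.
  apply: (@is_dist_uniq mt) d2 _; rewrite maps_targett_dark.
  by rewrite (slitW_inv S maps_origt_taut (ltnW ik) xW); apply/forward_distW/ltnW.
have [[t tp tn] _] := d1.
have := @potential_path mt okt o g d0 t x g_taut g_dk tp.
rewrite g0 tn n0i; apply/negP; rewrite -leqNgt.
have lx : l (dk x) = k - i.+1.
  by rewrite (slitV_inv S l_tau ik) ?l_dk // ax mem_cat aA.
(* An earlier approaching edge would give [k + 1 = g d0 <= g x + i <= (k - (i + 1)) + 1 + i = k];
   with [g_dk] instead, the bound would only be [k + 1]. *)
have := g_le x; rewrite lx => gx; apply: (leq_trans (leq_add gx (leqnn i))).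
by rewrite subnSK // subnK // ltnW.
Qed.

Lemma forward_lightest :
  @lightest_geodesic mt (reverse o) vt (last d0 s) (rev (d0 :: s)).
Proof.
have ne i : i <= k -> origt (dk (e i)) <> vt.
  move=> ik iv; have := forward_distW ik; rewrite iv => d.
  by have := @is_dist_uniq mt _ _ _ _ _ d (forward_dist_origin (leq0n k)).
have ne' i : i < k -> origt (e i.+1) <> vt by move=> ik; rewrite slit_origt //; apply/ne/ltnW.
have targV (x : E) : @target mt (reverse o) x = origt x by rewrite /target reverseK.
have oV (x : E) : @origin mt (reverse o) (LtV x) = origt x.
  by rewrite -(target_light okt) targV.
have oV' (x : E) : @origin mt (reverse o) x = origt (dk x) by rewrite -maps_targett_dark.
apply/(@lightest_nthP mt _ _ d0); split; last first.
  by rewrite rev_cons map_rcons last_rcons oV.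
move=> i; rewrite size_rev /= ltnS => ik; rewrite nth_rev //= subSS.
case: i ik => [_|i ik] /=.
  (* The reversed path starts with the very edge from which the search begins, accepted without
     turning. *)
  rewrite subn0 -maps_ek oV'; split; first exact: ne.
  by exists 0; split=> //; apply: forward_approaching.
rewrite (nth_map d0) ?size_rev //=; last exact: ltnW ik.
rewrite nth_rev //=; last exact: ltnW ik.
rewrite subSS.
have -> : k - i = (k - i.+1).+1 by rewrite subnSK.
have kk : k - i.+1 < k by rewrite ltn_subrL (leq_ltn_trans _ ik).
rewrite oV; split; first exact: (ne' _ kk).
exact: forward_first.
Qed.

End WithSlit.
End Dist.

Theorem forward_slide : [/\
  @lightest_geodesic mt (reverse o) vt (last d0 s) (rev (d0 :: s)),
  @approaching mt (reverse o) vt (last d0 s) & exists A B, slit' A B].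
Proof.
have [l lP] := dist_exists forward_conn; have [A [B S]] := forward_slit lP.
split; [exact: forward_lightest S| |by exists A, B].
by rewrite -maps_ek; apply: forward_approaching S _ _.
Qed.

End Forward.

(** * From the lightest geodesic of the slid map back to the old map *)

Section Backward.

Variable w : {set E}.
Hypothesis trt : bitransitive dk taut.
Hypothesis lgt : @lightest_geodesic mt (reverse o) w (last d0 s) (rev (d0 :: s)).

Let targV (x : E) : @target mt (reverse o) x = origt x.
Proof. by rewrite /target reverseK. Qed.

Let oV (x : E) : @origin mt (reverse o) (LtV x) = origt x.
Proof. by rewrite -(target_light okt) targV. Qed.

Lemma backward_nth :
  [/\ vt = w, @approaching mt (reverse o) w (e k)
    & forall i, i < k -> @first_approaching mt (reverse o) w (LtV (e i.+1)) (e i)].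
Proof.
have [h lE] := (@lightest_nthP mt _ _ d0 _ _).1 lgt; split.
- by move: lE; rewrite rev_cons map_rcons last_rcons oV.
- have lt0 : 0 < size (rev (d0 :: s)) by rewrite size_rev.
  have [_ [j [_ + _]]] := h 0 lt0.
  by rewrite nth_rev //= subn1.
move=> i ik; have ki : k - i < size (rev (d0 :: s)) by rewrite size_rev ltnS leq_subr.
have [_] := h _ ki; rewrite nth_rev; last by rewrite ltnS leq_subr.
rewrite [size _]/= subSS subKn; last exact: ltnW.
have -> : k - i = (k - i.+1).+1 by rewrite subnSK.
rewrite [nth d0 (last d0 s :: _) _]/=.
have kS : k - i.+1 < k.+1 by rewrite ltnS leq_subr.
by rewrite (nth_map d0) ?size_rev // nth_rev //= subSS subKn.
Qed.

(** [h] is indexed by origins for [o], although paths follow the reverse orientation, so that it is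
    invariant under [taut]; [LtV x] is an edge whose reversed origin is the origin of [x]. *)
Lemma backward_dist_exists :
  exists h : E -> nat, forall x, @is_dist mt (reverse o) (origt x) w (h x).
Proof.
have [vw _ _] := backward_nth.
have trV : bitransitive (@dark_step mt (reverse o)) (@turn mt (reverse o)).
  by apply/(connected_bitransitive okt)/(connected_bitransitive okt o).
have conn (x : edge mt) : exists t, is_path (reverse o) (origin (reverse o) x) t w.
  rewrite -vw -oV; exact: (bitransitive_strongly_connected okt trV).
have [l lP] := dist_exists conn; exists (fun x => l (LtV x)) => x.
by rewrite -oV; apply: lP.
Qed.

Section Dist.

Variable h : E -> nat.
Hypothesis hP : forall x, @is_dist mt (reverse o) (origt x) w (h x).

Lemma codist_origin x y : origt x = origt y -> h x = h y.
Proof. by move=> xy; apply: (@is_dist_uniq mt) (hP x) _; rewrite xy. Qed.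

Let h_taut x : h (taut x) = h x.
Proof. by apply: codist_origin; apply: maps_origt_taut. Qed.

Lemma codist_dark x : h (dk x) <= (h x).+1.
Proof.
have [_ hmin] := hP (dk x); have [[t tp <-] _] := hP x.
apply: (hmin (x :: t)); rewrite /= targV tp andbT.
by rewrite -maps_targett_dark eqxx.
Qed.

Lemma coapproachingE x :
  @approaching mt (reverse o) w x <-> h (dk x) = (h x).+1.
Proof.
split=> [[n [d1 d2]]|xE].
  rewrite targV in d2; rewrite (@is_dist_uniq mt _ _ _ _ _ (hP x) d2).
  apply: (@is_dist_uniq mt) (hP (dk x)) _.
  by rewrite -maps_targett_dark.
exists (h x); rewrite targV; split; last exact: hP.
have xo : @origin mt (reverse o) x = origt (dk x) by apply: maps_targett_dark.
by rewrite -xE xo; apply: hP.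
Qed.

Lemma backward_dist i : i <= k -> h (e i) = i /\ h (dk (e i)) = i.+1.
Proof.
have [vw apk fa] := backward_nth.
have h0 : h d0 = 0.
  by apply: (@is_dist_uniq mt) (hP d0) _; rewrite vw; split=> //; exists [::] => //=.
have ap j : j <= k -> h (dk (e j)) = (h (e j)).+1.
  rewrite leq_eqVlt => /predU1P[->|jk]; first exact/coapproachingE.
  by have [n [_ /coapproachingE]] := fa j jk.
suff H : i <= k -> h (e i) = i by move=> ik; rewrite ap // H.
elim: i => // i IHi ik; have [j [/esym/maps_tautV_light <- _ _]] := fa i ik.
rewrite (@codist_origin _ (dk (e i))); last exact: (origin_iter_turn okt).
by rewrite ap 1?ltnW // IHi // ltnW.
Qed.

(** Here it is the new vertices that are seen to be distinct: [h] takes the values 0, 1, ..., [k.+1]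
    on them. *)
Lemma backward_slit : exists A B, slit' A B.
Proof.
have [vw apk fa] := backward_nth.
have hL i : i <= k -> h (Lt (e i)) = i.+1.
  by move=> ik; rewrite -maps_tautE h_taut (backward_dist ik).2.
apply: maps_slit_fromW => [i ik|i j ik jk].
  have [j [/esym/maps_tautV_light <- _ _]] := fa i ik.
  by rewrite iterSr maps_tautE fconnect_iter.
move/(origin_eq okt)/codist_origin.
have h0 := (backward_dist (leq0n k)).1.
by case: i j ik jk => [|i] [|j] ik jk; rewrite ?hL // h0.
Qed.

Section WithSlit.

Variables (A B : nat -> seq E).
Hypothesis S : slit' A B.

Let h0 : h (e 0) = 0. Proof. exact: (backward_dist (leq0n k)).1. Qed.
Let h_dk i : i <= k -> h (dk (e i)) = i.+1. Proof. by case/backward_dist. Qed.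

(** If [dk x] lies in [A i.+1], the reversed search meets [x] strictly before [e i] and rejects it;
    on [A 0] the value of [h] is 0. *)
Lemma backward_lside x : lside k A (dk x) -> h (dk x) <= h x.
Proof.
have [vw apk fa] := backward_nth.
case/lsideP=> -[_|i ik] xi.
  by rewrite (backward_potential_A S h_taut h0 h_dk (leq0n k) xi).
have [n nA nE] := slit_run_W S ik xi; have [j [jE _ nap]] := fa i ik.
have nj : n < j.
  apply: leq_trans nA _; rewrite leqNgt; apply/negP=> jA.
  have [a aA aE] := slit_run_W_mem S ik jA.
  apply: (slitAB S ik (ltnW ik) aA); suff -> : a = dk (e i) by apply: slit_dark_mem_B S _ (ltnW ik).
  have /esym/maps_tautV_light := jE; rewrite -aE => /esym.
  by elim: (j.+1) => //= n' IHn /maps_inj_taut; apply: IHn.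
have := nap n nj; rewrite ((maps_tautV_light _ _ _).2 nE) => nap'.
have := codist_dark x; rewrite leq_eqVlt => /predU1P[/coapproachingE//|].
by rewrite ltnS.
Qed.

Let g x := h x + lside k A x.

Let g_tau x : g (tau x) = g x.
Proof. by apply: (backward_potential_inv S maps_inj_tau h_taut h0 h_dk). Qed.

Let g_le x : g (dk x) <= (h x).+1.
Proof.
rewrite /g; case: (boolP (lside k A (dk x))) => [/backward_lside lx|_].
  by rewrite addn1 ltnS.
by rewrite addn0; apply: codist_dark.
Qed.

Let g_dk x : g (dk x) <= (g x).+1.
Proof. by apply: leq_trans (g_le x) _; rewrite ltnS leq_addr. Qed.

Let gV i x : i <= k -> x \in A i ++ B i -> g x = i.+1.
Proof. exact: (backward_potential_V S h_taut h0 h_dk). Qed.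

Let orig_tau x : orig (tau x) = orig x. Proof. exact: origin_turn. Qed.

Let gz : g (L z) = k.+1.
Proof.
apply: gV => //; have := slit_head_mem_B S (leqnn k).
by rewrite mem_cat /block_head ltnn => ->; rewrite orbT.
Qed.

Lemma slit_orig i : i < k -> orig (e i.+1) = orig (dk (e i)).
Proof.
move=> ik; apply: (slitV_inv S orig_tau (ltnW ik)).
by rewrite mem_cat (slit_path_mem_B S ik) orbT.
Qed.

Lemma slit_orig_end : orig (dk (e k)) = v.
Proof.
symmetry; apply: (slitV_inv S orig_tau (leqnn k)).
have := slit_head_mem_B S (leqnn k).
by rewrite mem_cat /block_head ltnn => ->; rewrite orbT.
Qed.

Lemma slit_path n : n <= k -> is_path o (orig (dk (e (k - n)))) (drop (k - n) s) v.
Proof.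
elim: n => [_|n IHn nk]; first by rewrite subn0 drop_size /= slit_orig_end.
have nk' : k - n.+1 < k by rewrite ltn_subrL (leq_ltn_trans _ nk).
have IH := IHn (ltnW nk); rewrite -(subnSK nk) in IH.
rewrite (drop_nth d0) //; apply/andP; split; first exact/eqP/(slit_orig nk').
by rewrite target_dark.
Qed.

Lemma backward_distV i : i <= k -> is_dist o (orig (dk (e i))) v (k - i).
Proof.
move=> ik; split.
  exists (drop i s); last by rewrite size_drop.
  by have := slit_path (leq_subr i k); rewrite subKn.
move=> t tp; have := copotential_path ok g_tau g_dk tp.
by rewrite gz (gV ik) ?mem_cat ?(slit_dark_mem_B S ik) ?orbT // addSn ltnS leq_subLR.
Qed.

Lemma backward_first i : i < k -> first_approaching o v (L (e i)) (e i.+1).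
Proof.
move=> ik; exists (size (A i)); split.
- have := slit_run_V_size S (ltnW ik).
  by rewrite {1}/block_head ik.
- exists (k - i.+1); rewrite subnSK // target_dark //.
  by split; [rewrite slit_orig //; apply/backward_distV/ltnW|apply: backward_distV].
move=> n nA; have := slit_run_V_mem S (ltnW ik) nA; set x := iter n _ _ => xA.
case=> n0 [d1 d2]; have xV : x \in A i ++ B i by rewrite mem_cat xA.
have n0E : n0.+1 = k - i.
  apply: is_dist_uniq d1 _; rewrite (slitV_inv S orig_tau (ltnW ik) xV).
  exact/backward_distV/ltnW.
rewrite target_dark // in d2; have [[t tp tn] _] := d2.
have := copotential_path ok g_tau g_dk tp; apply/negP; rewrite -ltnNge gz tn.
(* As in the other direction, an earlier approaching edge would give [k + 1 = g (L z) <= g (dk x) +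
   n0 <= (i + 1) + n0 = k]. *)
have := g_le x; rewrite (backward_potential_A S h_taut h0 h_dk (ltnW ik) xA) => gx.
rewrite ltnS; apply: leq_trans (leq_add gx (leqnn n0)) _.
by rewrite addSnnS n0E subnKC // ltnW.
Qed.

Lemma backward_lightest : lightest_geodesic o v d0 s.
Proof.
have oL x : orig (L x) = orig (dk x) by rewrite -maps_tauE origin_turn.
apply/lightestV_nthP; split; last by rewrite oL slit_orig_end.
move=> i ik; split; last exact: backward_first.
rewrite oL => iv; have := backward_distV (ltnW ik); rewrite iv => d.
have d' : is_dist o v v 0 by split=> //; exists [::] => //=.
by have := is_dist_uniq d d'; apply/eqP; rewrite subn_eq0 -ltnNge.
Qed.

End WithSlit.
End Dist.

Theorem backward_slide : [/\ vt = w,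
  lightest_geodesic o v d0 s & exists A B, slit' A B].
Proof.
have [h hP] := backward_dist_exists; have [A [B S]] := backward_slit hP.
have [vw _ _] := backward_nth.
by split; [ |exact: backward_lightest S|exists A, B].
Qed.

End Backward.

Lemma slit_vertices A B : slit' A B -> #|vertices mt| = #|vertices m|.+1.
Proof.
move=> S; rewrite (verticesE okt o) (verticesE ok o).
by apply: (slit_card_orbits S maps_inj_tau maps_inj_taut (origin_eq ok o) (origin_eq okt o)).
Qed.

Lemma slit_connected A B : slit' A B -> connected_map m <-> connected_map mt.
Proof.
move=> S; split=> c.
  apply/(connected_bitransitive okt o)/(slit_bitransitiveW S).
  exact/(connected_bitransitive ok o).
apply/(connected_bitransitive ok o)/(slit_bitransitiveV S).
exact/(connected_bitransitive okt o).
Qed.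
End SlideMaps.

(** * Contours of light faces *)

Lemma next_cons (T : eqType) (d h : T) t x : uniq (d :: h :: t) -> x \in h :: t ->
  next (d :: h :: t) x = if x == last h t then d else next (h :: t) x.
Proof.
move=> u xt; have /andP[dt ut] := u.
have xd : (d == x) = false by apply/negP=> /eqP dx; rewrite dx xt in dt.
rewrite !next_nth xt inE xt orbT /= xd.
have [xl|xl] := eqVneq x (last h t).
  by rewrite xl -[h == _]/(_ == _); have := index_last ut => /= ->; rewrite nth_default.
have it : index x (h :: t) < size t.
  have : index x (h :: t) < size (h :: t) by rewrite index_mem.
  rewrite [size _]/= ltnS leq_eqVlt => /predU1P[xi|//].
  by rewrite (last_nth h) -xi nth_index // eqxx in xl.
by apply: set_nth_default.
Qed.

Lemma next_last (T : eqType) (h : T) t : uniq (h :: t) -> next (h :: t) (last h t) = h.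
Proof.
move=> u; rewrite next_nth mem_last index_last //.
by rewrite nth_default.
Qed.

(** Read from the corner, the insertion is always at the head. This treats all corners alike,
    including [0] and [size f], which are the same place on the cycle but mark the new contour
    differently. *)
Lemma rot_insert_at (T : Type) j (d : T) f : j <= size f ->
  rot j (insert_at j d f) = d :: rot j f.
Proof.
move=> jf; have sj : size (take j f) = j by apply: size_takel.
by rewrite /insert_at /rot drop_size_cat // take_size_cat.
Qed.

Lemma map_insert_at (T S : Type) (g : T -> S) j d f :
  map g (insert_at j d f) = insert_at j (g d) (map g f).
Proof. by rewrite /insert_at map_cat /= map_take map_drop. Qed.

Lemma perm_insert_at (T : eqType) j (d : T) f : perm_eq (insert_at j d f) (d :: f).
Proof. by rewrite /insert_at -cat1s perm_catCA cat_take_drop. Qed.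

Lemma index_insert_at (T : eqType) j (d : T) f : j <= size f -> d \notin f ->
  index d (insert_at j d f) = j.
Proof.
move=> jf df; rewrite /insert_at index_cat ifN.
  by rewrite /= eqxx addn0 size_takel.
by apply: contra df; apply: mem_take.
Qed.

Lemma insert_at_rem (T : eqType) (d : T) f : d \in f ->
  insert_at (index d f) d (rem d f) = f.
Proof.
move=> df; have jf : index d f < size f by rewrite index_mem.
have sj : size (take (index d f) f) = index d f by apply/size_takel/ltnW.
rewrite remE /insert_at take_size_cat // drop_size_cat //.
by rewrite -{2}(nth_index d df) -drop_nth // cat_take_drop.
Qed.

Lemma rem_insert_at (T : eqType) j (d : T) f : j <= size f -> d \notin f ->
  rem d (insert_at j d f) = f.
Proof.
move=> jf df; have sj : size (take j f) = j by apply: size_takel.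
rewrite remE index_insert_at // /insert_at take_size_cat // drop_cat sj ltnNge leqnSn /=.
by rewrite subSnn /= drop0 cat_take_drop.
Qed.

Lemma map_full_slide (T : eqType) (d0 : T) s f : d0 \notin f ->
  map (slide d0 s) f = map (full_slide d0 s) f.
Proof.
move=> df; apply/eq_in_map => x xf; apply: slideE.
by apply: contraNneq df => <-.
Qed.

Lemma maps_full_slide (T : eqType) (d0 : T) s fs : d0 \notin flatten fs ->
  map (map (slide d0 s)) fs = map (map (full_slide d0 s)) fs.
Proof.
move=> df; apply/eq_in_map => f ffs; apply: map_full_slide.
by apply: contra df => d0f; apply/flattenP; exists f.
Qed.

Lemma perm_map_enum (T : finType) (g : T -> T) s : injective g ->
  perm_eq s (enum T) -> perm_eq (map g s) (enum T).
Proof.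
move=> ig sE; apply: uniq_perm; rewrite ?enum_uniq //.
  by rewrite (map_inj_uniq ig) (perm_uniq sE) enum_uniq.
move=> x; rewrite mem_enum; have [g' _ gK] := injF_bij ig.
by rewrite -(gK x) (mem_map ig) (perm_mem sE) mem_enum.
Qed.

(** * Closing f_1 and lengthening f_2 as a slide *)

Section Insert.

Variables (m : shaded_map) (d0 : edge m) (f2 : seq (edge m)) (fs : seq (seq (edge m))).
Variables (j : nat) (s : seq (edge m)).
Hypotheses (ok : faces_ok m) (lm : light m = [:: d0] :: f2 :: fs).
Hypotheses (us : uniq (d0 :: s)) (f2_gt0 : 0 < size f2) (jf : j <= size f2).

Local Notation m' := (ShadedMap (insert_at j d0 f2 :: fs) (dark m)).
Local Notation mt := (sss_minus d0 f2 fs j s).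
Local Notation sg := (full_slide d0 s).

Let flatE : flatten (light m) = d0 :: f2 ++ flatten fs.
Proof. by rewrite lm. Qed.

Let d0_notin : (d0 \notin f2) /\ (d0 \notin flatten fs).
Proof.
have := faces_uniq ok; rewrite flatE /= mem_cat negb_or.
by case/andP=> /andP[].
Qed.

Lemma insert_ok : faces_ok m'.
Proof.
apply: perm_trans ok; rewrite flatE /= -cat_cons perm_cat2r.
exact: perm_insert_at.
Qed.

(** As [sg] sends [d0] to the inserted side, [mt] is the renaming of [m'], where the loop itself is
    inserted. Insertion and bijective renaming can then be studied separately. *)
Lemma sss_minus_light : light mt = map (map sg) (insert_at j d0 f2 :: fs).
Proof.
have [h1 h2] := d0_notin.
by rewrite /= map_insert_at full_slide_d0 map_full_slide // maps_full_slide.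
Qed.

Lemma sss_minus_ok : faces_ok mt.
Proof.
rewrite /faces_ok sss_minus_light -map_flatten.
by apply: perm_map_enum insert_ok; apply: full_slide_inj.
Qed.

Lemma sss_minus_step o (x : edge m) :
  @light_step mt o (sg x) = sg (@light_step m' o x).
Proof.
have LL (y : edge m) : @light_step mt LightLeft (sg y) = sg (@light_step m' LightLeft y).
  have [fm yf] := @mem_light_face m' insert_ok y.
  have yf' : sg y \in map sg (light_face (y : edge m')) by apply: map_f.
  have fm' : map sg (light_face (y : edge m')) \in light mt.
    by rewrite sss_minus_light map_f.
  rewrite (light_step_next sss_minus_ok fm' yf') /=.
  by rewrite (next_map (full_slide_inj us)) //; apply: light_face_uniq insert_ok _.
case: o; first exact: LL.
rewrite -{1}[x](@light_stepVK m' insert_ok LightLeft) -LL.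
exact: (@light_stepK mt sss_minus_ok LightLeft).
Qed.

Definition inserts o (z : edge m) := [/\ @light_step m o d0 = d0, z <> d0,
  @light_step m' o z = d0, @light_step m' o d0 = @light_step m o z
  & forall x : edge m, x <> d0 -> x <> z -> @light_step m' o x = @light_step m o x].

(** The edge before the exit corner depends on the orientation: the two edges around the corner
    exchange roles. *)
Lemma inserts_rev (z : edge m) : inserts LightLeft z -> inserts LightRight (light_step LightLeft z).
Proof.
case=> ld zd lz l'd lx.
have K (x : edge m) : @light_step m LightRight (light_step LightLeft x) = x.
  exact: (light_stepK ok LightLeft).
have VK (x : edge m) : @light_step m LightLeft (light_step LightRight x) = x.
  exact: (light_stepVK ok LightLeft).
have K' (x : edge m) : @light_step m' LightRight (@light_step m' LightLeft x) = x.
  exact: (light_stepK insert_ok LightLeft).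
split.
- by rewrite -{1}ld K.
- by move=> h; apply: zd; rewrite -(K z) h -{1}ld K.
- by rewrite -l'd K'.
- by rewrite K; have := K' z; rewrite lz.
move=> x xd xz; rewrite -{1}(VK x) -lx ?K' //.
  by move=> h; apply: xd; rewrite -(VK x) h ld.
by move=> h; apply: xz; rewrite -(VK x) h.
Qed.

Let rotE : exists h t, rot j f2 = h :: t.
Proof.
case E: (rot j f2) => [|h t]; last by exists h, t.
by move: f2_gt0; rewrite -(size_rot j) E.
Qed.

Lemma inserts_left : exists2 z, inserts LightLeft z
  & light_step LightLeft z = head d0 (rot j f2).
Proof.
have [h [t rE]] := rotE; have [df2 dfs] := d0_notin.
have f2m : f2 \in light m by rewrite lm !inE eqxx orbT.
have uf2 : uniq f2 by apply: uniq_flatten_mem f2m; apply: faces_uniq.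
have uht : uniq (h :: t) by rewrite -rE rot_uniq.
have udht : uniq (d0 :: h :: t) by rewrite cons_uniq uht -rE mem_rot df2.
have f2'm : insert_at j d0 f2 \in light m' by rewrite inE eqxx.
have uf2' : uniq (insert_at j d0 f2) by rewrite (perm_uniq (perm_insert_at _ _ _)) /= df2.
have L2 (x : edge m) : x \in f2 -> @light_step m LightLeft x = next (h :: t) x.
  by move=> xf; rewrite (light_step_next ok f2m xf) -rE next_rot.
have L2' (x : edge m) : x \in d0 :: f2 -> @light_step m' LightLeft x = next (d0 :: h :: t) x.
  rewrite -(perm_mem (perm_insert_at j d0 f2)) => xf.
  by rewrite (light_step_next insert_ok f2'm xf) -rE -rot_insert_at // next_rot.
have hf2 x : (x \in f2) = (x \in h :: t) by rewrite -rE mem_rot.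
have zf2 : last h t \in f2 by rewrite hf2 mem_last.
exists (last h t); last by rewrite L2 // next_last // rE.
split.
- have d0m : [:: d0] \in light m by rewrite lm inE eqxx.
  by rewrite (light_step_next ok d0m) ?mem_head //= eqxx.
- by move=> zd; rewrite -zd zf2 in df2.
- by rewrite L2' ?inE ?zf2 ?orbT // next_cons ?mem_last // eqxx.
- by rewrite L2' ?mem_head // L2 // next_last //= eqxx.
move=> x /eqP xd /eqP xz; have [xf|xf] := boolP (x \in f2).
  by rewrite L2' ?inE ?xf ?orbT // L2 // next_cons -?hf2 // (negPf xz).
have [fm xfm] := mem_light_face ok x.
have ffs : light_face x \in fs.
  move: fm xfm; rewrite lm !inE => /predU1P[->|/predU1P[->|//]].
    by rewrite inE (negPf xd).
  by rewrite (negPf xf).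
rewrite (light_step_next ok fm xfm) (@light_step_next m' insert_ok (light_face x)) //.
by rewrite inE ffs orbT.
Qed.

Lemma sss_minus_slides o : exists2 z,
  @slides_to m (light mt) o d0 z s & corner_vertex d0 f2 j = origin o (light_step o z).
Proof.
have [z iz zh] := inserts_left.
have [z' [ld zd lz l'd lx] cz] : exists2 z', inserts o z'
    & corner_vertex d0 f2 j = origin o (light_step o z').
  case: o; first by exists z; rewrite // zh.
  exists (light_step LightLeft z); first exact: inserts_rev.
  rewrite /corner_vertex -zh /origin (light_stepK ok LightLeft).
  by [].
exists z' => //; split=> //.
- by move=> x xd xz; rewrite -[RHS](congr1 sg (lx x xd xz)); apply: sss_minus_step.
- by have := sss_minus_step o z'; rewrite lz full_slide_d0.
- by have := sss_minus_step o d0; rewrite l'd full_slide_d0.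
Qed.

End Insert.

Lemma map_slide_rev (T : eqType) (d0 e1 : T) (s s' f : seq T) :
  uniq (d0 :: s) -> rev (d0 :: s) = e1 :: s' -> d0 \notin f ->
  map (slide e1 s') (map (slide d0 s) f) = f.
Proof.
move=> us revE df; rewrite -map_comp -[RHS]map_id; apply/eq_in_map => x xf /=.
by apply: slide_rev => //; apply: contraNneq df => <-.
Qed.

Lemma maps_slide_rev (T : eqType) (d0 e1 : T) (s s' : seq T) fs :
  uniq (d0 :: s) -> rev (d0 :: s) = e1 :: s' -> d0 \notin flatten fs ->
  map (map (slide e1 s')) (map (map (slide d0 s)) fs) = fs.
Proof.
move=> us revE df; rewrite -map_comp -[RHS]map_id; apply/eq_in_map => f ffs /=.
apply: map_slide_rev => //; apply: contra df => d0f.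
by apply/flattenP; exists f.
Qed.

(** * The two surgeries cancel on contours *)

Section SssMinusK.

Variables (m : shaded_map) (d0 : edge m) (f2 : seq (edge m)) (fs : seq (seq (edge m))).
Variables (j : nat) (s : seq (edge m)) (e1 : edge m) (s' : seq (edge m)).
Hypotheses (ok : faces_ok m) (lm : light m = [:: d0] :: f2 :: fs).
Hypotheses (us : uniq (d0 :: s)) (jf : j <= size f2).
Hypothesis revE : rev (d0 :: s) = e1 :: s'.

Let f2t := insert_at j (last d0 s) (map (slide d0 s) f2).

Lemma loop_notin : d0 \notin f2 /\ d0 \notin flatten fs.
Proof.
have := faces_uniq ok; rewrite lm /= mem_cat negb_or.
by case/andP=> /andP[].
Qed.

Let e1_notin : e1 \notin map (slide d0 s) f2.
Proof.
have [df2 _] := loop_notin; have [<- _] := rev_path_last revE.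
by rewrite map_full_slide // -full_slide_d0 (mem_map (full_slide_inj us)).
Qed.

Lemma sss_minusK :
  light (@sss_plus (sss_minus d0 f2 fs j s) f2t (map (map (slide d0 s)) fs) e1 s') = light m.
Proof.
have [df2 dfs] := loop_notin; have [le le'] := rev_path_last revE.
rewrite /= le' lm /f2t le rem_insert_at ?size_map //.
by rewrite map_slide_rev // maps_slide_rev.
Qed.

Lemma index_sss_minus : index e1 f2t = j.
Proof.
by have [le _] := rev_path_last revE; rewrite /f2t le index_insert_at // size_map.
Qed.

End SssMinusK.

Section SssPlus.

Variables (M : shaded_map) (f2 : seq (edge M)) (fs : seq (seq (edge M))).
Variables (e1 : edge M) (s' : seq (edge M)) (d0 : edge M) (s : seq (edge M)).
Hypotheses (ok : faces_ok M) (lM : light M = f2 :: fs) (ef2 : e1 \in f2).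
Hypotheses (us : uniq (e1 :: s')) (revE : rev (e1 :: s') = d0 :: s).

Local Notation N := (sss_plus f2 fs e1 s').

Let uflat : uniq (e1 :: rem e1 f2 ++ flatten fs).
Proof.
have u : uniq (f2 ++ flatten fs) by have := faces_uniq ok; rewrite lM.
by rewrite -cat_cons -(perm_uniq (perm_cat (perm_to_rem ef2) (perm_refl _))).
Qed.

Let e1_notin : e1 \notin rem e1 f2 /\ e1 \notin flatten fs.
Proof. by have := uflat; rewrite cons_uniq mem_cat negb_or => /andP[/andP[]]. Qed.

Lemma sss_plus_ok : faces_ok N.
Proof.
have [h1 h2] := e1_notin.
rewrite /faces_ok /= map_full_slide // maps_full_slide // -map_flatten -map_cat.
rewrite -full_slide_d0 -map_cons; apply: perm_map_enum; first exact: full_slide_inj.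
apply: perm_trans ok; rewrite lM /= -cat_cons perm_cat2r perm_sym.
exact: perm_to_rem.
Qed.

Lemma sss_plus_light :
  light N = [:: d0] :: map (slide e1 s') (rem e1 f2) :: map (map (slide e1 s')) fs.
Proof. by rewrite /=; have [_ ->] := rev_path_last (rev_swap revE). Qed.

Lemma sss_plusK :
  light (@sss_minus N d0 (map (slide e1 s') (rem e1 f2)) (map (map (slide e1 s')) fs)
           (index e1 f2) s) = light M.
Proof.
have [h1 h2] := e1_notin; have [le _] := rev_path_last (rev_swap revE).
rewrite /= lM map_slide_rev // maps_slide_rev // le.
by rewrite insert_at_rem.
Qed.

End SssPlus.

Lemma slit_hypermap (m : shaded_map) (lt : seq (seq (edge m))) o d0 z s A B p b b' :
  let mt := ShadedMap lt (dark m) in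
  faces_ok m -> faces_ok mt ->
  slit (@light_step m o) (@turn m o) (@turn mt o : edge m -> edge m) (@dark_step m o)
    (size s) (nth d0 (d0 :: s)) z A B ->
  size (light m) = (size lt).+1 -> shape (light m) = b -> shape lt = b' ->
  is_hypermap m p b <-> is_hypermap mt p b'.
Proof.
move=> mt ok okt S sz sb sb'.
have V := slit_vertices ok okt S; have C := slit_connected ok okt S.
split=> -[_ _ h3 h4 h5].
  split; [exact: okt|exact: sb'|exact: h3|exact/C|].
  by rewrite V; move: h5; rewrite sz !addSn !addnS.
split; [exact: ok|exact: sb|exact: h3|exact/C|].
by move: h5; rewrite V sz /= !addSn !addnS.
Qed.

(** * Transport along isomorphisms *)

Section Iso.

Variables (m m' : shaded_map) (f : edge m -> edge m').
Hypotheses (iso : is_iso f) (ok : faces_ok m).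
Implicit Types (o : orientation) (x y : edge m) (u w : {set edge m}).

Lemma iso_inj : injective f.
Proof. by case: iso => /bij_inj. Qed.

Lemma iso_surj (x' : edge m') : exists x, x' = f x.
Proof. by case: iso => -[g _ gK] _ _; exists (g x'). Qed.

Lemma iso_light_face x : light_face (f x) = map f (light_face x).
Proof.
have [_ lE _] := iso; have [fm xf] := mem_light_face ok x.
rewrite /light_face lE find_map.
rewrite (@eq_find _ _ (fun g => x \in g)); last by move=> g /=; rewrite (mem_map iso_inj).
rewrite (nth_map [::]) // -has_find; apply/hasP.
by exists (light_face x).
Qed.

Lemma iso_light_step o x : light_step o (f x) = f (light_step o x).
Proof.
have u := light_face_uniq ok x.
case: o; rewrite /light_step iso_light_face; first exact: (next_map iso_inj).
exact: (prev_map iso_inj).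
Qed.

Lemma iso_dark_step o x : dark_step o (f x) = f (dark_step o x).
Proof.
have [_ _ dE] := iso; case: o => /=; first exact: dE.
by apply: (@perm_inj _ (dark m')); rewrite permKV dE permKV.
Qed.

Lemma iso_turn o x : turn o (f x) = f (turn o x).
Proof. by rewrite /turn iso_dark_step iso_light_step. Qed.

Lemma iso_iter_turn o n x : iter n (turn o) (f x) = f (iter n (turn o) x).
Proof. by elim: n => //= n ->; rewrite iso_turn. Qed.

Lemma iso_left_origin x : left_origin (f x) = f @: left_origin x.
Proof.
apply/setP=> y'; have [y ->] := iso_surj y'.
rewrite (mem_imset _ _ iso_inj) !inE.
apply/idP/idP => /iter_findex; last by move=> <-; rewrite -iso_iter_turn fconnect_iter.
by rewrite iso_iter_turn => /iso_inj <-; apply: fconnect_iter.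
Qed.

Lemma iso_origin o x : origin o (f x) = f @: origin o x.
Proof.
case: o; first exact: iso_left_origin.
by rewrite /origin iso_light_step iso_left_origin.
Qed.

Lemma iso_target o x : target o (f x) = f @: target o x.
Proof. exact: iso_origin. Qed.

Lemma iso_path o u s w : is_path o (f @: u) (map f s) (f @: w) = is_path o u s w.
Proof.
have inj := imset_inj iso_inj.
elim: s u => [|x s IHs] u /=; first by rewrite (inj_eq inj).
by rewrite iso_origin (inj_eq inj) iso_target IHs.
Qed.

Lemma iso_seq (s' : seq (edge m')) : exists s, s' = map f s.
Proof.
elim: s' => [|x' s' [s ->]]; first by exists [::].
by have [x ->] := iso_surj x'; exists (x :: s).
Qed.

Lemma iso_dist o u w n : is_dist o (f @: u) (f @: w) n <-> is_dist o u w n.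
Proof.
split=> -[[s sp sn] smin].
  have [t tE] := iso_seq s; rewrite tE iso_path size_map in sp sn.
  split; first by exists t.
  by move=> t' tp; rewrite -(size_map f); apply: smin; rewrite iso_path.
split; first by exists (map f s); rewrite ?iso_path ?size_map.
by move=> t; have [t' ->] := iso_seq t; rewrite iso_path size_map; apply: smin.
Qed.

Lemma iso_approaching o w x : approaching o (f @: w) (f x) <-> approaching o w x.
Proof.
rewrite /approaching iso_origin iso_target.
by split=> -[n [d1 d2]]; exists n; split; apply/iso_dist.
Qed.

Lemma iso_lightest o w x s :
  lightest_geodesic o w x s -> lightest_geodesic o (f @: w) (f x) (map f s).
Proof.
have inj := imset_inj iso_inj.
elim=> {x s} [x xw|x j s xw ap nap _ IHs].
  by apply: Lightest_end; rewrite iso_origin xw.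
rewrite /= -iso_iter_turn; apply: Lightest_step.
- by rewrite iso_origin => /inj.
- by rewrite iso_iter_turn; apply/iso_approaching.
- by move=> i ij; rewrite iso_iter_turn => /iso_approaching; apply: nap.
- by rewrite iso_iter_turn iso_light_step.
Qed.

End Iso.

Lemma slide_map (T S : eqType) (f : T -> S) d0 s x : injective f ->
  slide (f d0) (map f s) (f x) = f (slide d0 s x).
Proof.
move=> inj; rewrite /slide (mem_map inj) (index_map inj); case: ifP => // xs.
by rewrite -[f d0 :: _]/(map f (d0 :: s)) (nth_map d0) //= ltnS ltnW // index_mem.
Qed.

Lemma map_slide_map (T S : eqType) (f : T -> S) d0 s g : injective f ->
  map (slide (f d0) (map f s)) (map f g) = map f (map (slide d0 s) g).
Proof.
by move=> inj; rewrite -!map_comp; apply/eq_map => x /=; apply: slide_map.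
Qed.

Lemma maps_slide_map (T S : eqType) (f : T -> S) d0 s gs : injective f ->
  map (map (slide (f d0) (map f s))) (map (map f) gs) = map (map f) (map (map (slide d0 s)) gs).
Proof.
by move=> inj; rewrite -!map_comp; apply/eq_map => x /=; apply: map_slide_map.
Qed.

Lemma rem_map (T S : eqType) (f : T -> S) x g : injective f ->
  rem (f x) (map f g) = map f (rem x g).
Proof.
by move=> inj; elim: g => //= y g IHg; rewrite (inj_eq inj); case: ifP => //= _; rewrite IHg.
Qed.

(** * The bijection *)

Lemma hypermap_conn (m : shaded_map) p b o v : is_hypermap m p b -> v \in vertices m ->
  forall x : edge m, exists s, is_path o (origin o x) s v.
Proof.
case=> ok _ _ c _; rewrite (verticesE ok o) => /imsetP[y _ ->] x.
by apply: (bitransitive_strongly_connected ok); apply/(connected_bitransitive ok).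
Qed.

Lemma corner_vertex_vertex (m : shaded_map) (d0 : edge m) f j :
  corner_vertex d0 f j \in vertices m.
Proof. exact: imset_f. Qed.

Lemma hypermap_faces (m : shaded_map) p a2 b : is_hypermap m p [:: 1, a2 & b] ->
  exists d0 f2 fs, light m = [:: d0] :: f2 :: fs /\ size f2 = a2.
Proof.
case=> _ + _ _ _; case: (light m) => [|[|d0 [|? ?]] [|f2 fs]] //= [<- _].
by exists d0, f2, fs.
Qed.

Lemma loop_light_step (m : shaded_map) (d0 : edge m) fs o : faces_ok m ->
  light m = [:: d0] :: fs -> light_step o d0 = d0.
Proof.
move=> ok lm; have fE : light_face d0 = [:: d0].
  by apply: (light_faceE (faces_uniq ok)); rewrite ?lm mem_head.
by case: o; rewrite /light_step fE /= eqxx.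
Qed.

Lemma simple_path_uniq (m : shaded_map) o (u : {set edge m}) s w :
  is_simple_path o u s w -> uniq s.
Proof. by case/andP=> _ /= /andP[_ /map_uniq]. Qed.

(** The loop ends at the vertex where the path starts, and a simple path never returns there. *)
Lemma loop_simple_uniq (m : shaded_map) (d0 : edge m) fs o s w : faces_ok m ->
  light m = [:: d0] :: fs -> is_simple_path o (origin o d0) s w -> uniq (d0 :: s).
Proof.
move=> ok lm sp; rewrite /= (simple_path_uniq sp) andbT.
case/andP: sp => _ /= /andP[+ _]; apply: contra => ds.
apply/mapP; exists d0 => //.
by rewrite target_light // (loop_light_step _ ok lm).
Qed.

Section Psi.

Variables (p a2 : nat) (b : seq nat) (o : orientation).
Hypothesis a2_gt0 : 0 < a2.
Local Notation ot := (reverse o).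
Local Notation inN := (is_N p [:: 1, a2 & b]).
Local Notation inNt := (is_Nt p (a2.+1 :: b) o).

Lemma Psi_minus_exists x : inN x -> exists y, Psi_minus o x y.
Proof.
case: x => m j [/= hm jf]; have [d0 [f2 [fs [lm sf2]]]] := hypermap_faces hm.
have conn := hypermap_conn ot hm (corner_vertex_vertex d0 f2 j).
have ok : faces_ok m by case: hm.
have [s lg] := lightest_exists ok conn d0.
have [_ _ sp] := lightest_dist ok conn lg.
by eexists; exists d0, f2, fs, s; split; [exact: lm|exact: lg|exact: sp|].
Qed.

(** The sliding theory is used with [reverse o], so that the reversed path is the lightest geodesic
    for [o]. *)
Lemma Psi_minus_spec m j (d0 : edge m) f2 fs s : is_hypermap m p [:: 1, a2 & b] ->
  light m = [:: d0] :: f2 :: fs -> j <= size f2 ->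
  lightest_geodesic ot (corner_vertex d0 f2 j) d0 s ->
  is_simple_path ot (origin ot d0) s (corner_vertex d0 f2 j) ->
  let mt := sss_minus d0 f2 fs j s in
  [/\ uniq (d0 :: s), is_hypermap mt p (a2.+1 :: b),
      @lightest_geodesic mt o (@origin mt ot d0) (last d0 s) (rev (d0 :: s))
    & @leaving mt ot (@origin mt ot d0) (last d0 s)].
Proof.
move=> hm lm jf lg sp mt; have [ok sm _ c _] := hm.
have [sf2 sfs] : a2 = size f2 /\ b = shape fs by move: sm; rewrite lm => -[-> ->].
have us := loop_simple_uniq ok lm sp.
have f2_gt0 : 0 < size f2 by rewrite -sf2.
have okt : faces_ok mt by apply: (sss_minus_ok j ok lm us).
have [z st cz] := sss_minus_slides ok lm us f2_gt0 jf ot.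
have tr : bitransitive (@dark_step m ot) (@turn m ot) by apply/(connected_bitransitive ok).
rewrite cz in lg; have [lgt ap [A [B S]]] := forward_slide ok okt st us tr lg.
rewrite reverseK in lgt ap.
split; [exact: us| |exact: lgt|exact/leaving_rev].
apply: (@slit_hypermap m (light mt) ot d0 z s A B p _ _ ok okt S _ sm _).1 hm.
  by rewrite lm /= size_map.
rewrite /= (perm_size (perm_insert_at _ _ _)) /= size_map -sf2 sfs; congr (_ :: _).
by rewrite /shape -map_comp; apply: eq_map => g /=; rewrite size_map.
Qed.

Lemma Psi_minus_in x y : inN x -> Psi_minus o x y -> inNt y.
Proof.
case: x => m j [/= hm jf] [d0 [f2 [fs [s [lm lg sp ->]]]]].
rewrite lm /= in jf; have [us hmt _ lv] := Psi_minus_spec hm lm jf lg sp.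
have okt : faces_ok (sss_minus d0 f2 fs j s) by case: hmt.
split=> //=; first exact: (origin_vertex okt).
by rewrite (perm_mem (perm_insert_at _ _ _)) mem_head.
Qed.

(** The constructed [N] plays the map with the loop and the given [M] the slid map: by [sss_plusK],
    sliding [N] yields the contours of [M], so [backward_slide] applies. *)
Lemma Psi_plus_spec M (v : {set edge M}) f2 fs e1 s' d0 s :
  is_hypermap M p (a2.+1 :: b) -> light M = f2 :: fs -> e1 \in f2 ->
  lightest_geodesic o v e1 (e1 :: s') -> uniq (e1 :: s') -> rev (e1 :: s') = d0 :: s ->
  let N := sss_plus f2 fs e1 s' in
  [/\ is_hypermap N p [:: 1, a2 & b], @origin M ot d0 = v
    & @lightest_geodesic N ot
        (@corner_vertex N d0 (map (slide e1 s') (rem e1 f2)) (index e1 f2)) d0 s].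
Proof.
case: M v f2 fs e1 s' d0 s => E ls D v f2 fs e1 s' d0 s hM lM ef2 lg us' revE N.
have [ok sM _ c _] := hM.
have [sf2 sfs] : a2.+1 = size f2 /\ b = shape fs by move: sM; rewrite lM => -[-> ->].
have lN := sss_plus_light f2 fs revE.
have okN : faces_ok N by apply: (sss_plus_ok ok lM ef2 us').
have us : uniq (d0 :: s) by rewrite -revE rev_uniq.
have sr : size (rem e1 f2) = a2 by rewrite size_rem // -sf2.
have f2_gt0 : 0 < size (map (slide e1 s') (rem e1 f2)) by rewrite size_map sr.
have jf : index e1 f2 <= size (map (slide e1 s') (rem e1 f2)).
  by rewrite size_map sr -ltnS sf2 index_mem.
have [z st cz] := @sss_minus_slides N _ _ _ _ _ okN lN us f2_gt0 jf ot.
rewrite (sss_plusK ok lM ef2 us' revE) in st.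
have trt : bitransitive (@dark_step N ot) (@turn (ShadedMap ls D) ot : edge N -> edge N).
  exact: (connected_bitransitive ok ot).1.
have [le _] := rev_path_last (rev_swap revE).
have lg' : @lightest_geodesic (ShadedMap ls D) (reverse ot) v (last d0 s) (rev (d0 :: s)).
  by rewrite reverseK le (rev_swap revE).
have [vE lgN [A [B S]]] := @backward_slide N ls ot d0 z s okN ok st us v trt lg'.
split; [|exact: vE|by rewrite cz].
apply: (@slit_hypermap N ls ot d0 z s A B p _ _ okN ok S _ _ sM).2 hM.
  by rewrite lN -[ls]/(light (ShadedMap ls D)) lM /= size_map.
rewrite lN /= size_map sr sfs; congr [:: _, _ & _].
by rewrite /shape -map_comp; apply: eq_map => g /=; rewrite size_map.
Qed.

(** Leaving [v] in one orientation is approaching it in the other, so the search accepts [x] at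
    once. *)
Lemma Psi_plus_first M (v : {set edge M}) x e1 s : leaving ot v x ->
  lightest_geodesic o v x (e1 :: s) -> e1 = x.
Proof.
move/leaving_rev=> ap /(lightest_nthP _ _ x)[/(_ 0 isT)[_ [j [/= jE _ nap]]] _].
by case: j jE nap => // j _ /(_ 0 isT).
Qed.

Lemma Psi_plus_exists y : inNt y -> exists x, Psi_plus o y x.
Proof.
case: y => M v x [/= hM vM xf lv].
have [f2 [fs lM]] : exists f2 fs, light M = f2 :: fs.
  by case: hM => _ + _ _ _; case: (light M) => // f2 fs _; exists f2, fs.
have conn := hypermap_conn o hM vM.
have ok : faces_ok M by case: hM.
have [[|e1 s] lg] := lightest_exists ok conn x.
  (* An empty geodesic would put the origin of [x] at [v], but an approaching edge starts at
     positive distance. *)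
  have [n [d1 _]] : approaching o v x by apply/leaving_rev.
  inversion lg as [? xv|]; rewrite xv in d1.
  by have [_ /(_ [::])] := d1; rewrite /= eqxx => /(_ isT).
have [_ _ sp] := lightest_dist ok conn lg.
eexists; exists f2, fs, e1, s; split; [exact: lM|exact: lg|exact: sp| |reflexivity].
by rewrite (Psi_plus_first lv lg); move: xf; rewrite lM.
Qed.

Lemma Psi_plus_in y x : inNt y -> Psi_plus o y x -> inN x.
Proof.
case: y => M v e [/= hM vM xf lv] [f2 [fs [e1 [s' [/= lM lg sp ef2 ->]]]]].
have ee1 := Psi_plus_first lv lg; rewrite -ee1 in lg.
have us := simple_path_uniq sp; have [d0 [s revE]] := rev_consE e1 s'.
have [hN _ _] := Psi_plus_spec hM lM ef2 lg us revE.
split=> //=; rewrite size_map size_rem // -ltnS prednK ?index_mem //.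
by case: (f2) ef2.
Qed.

(** By uniqueness, the path found by [Psi_plus] is the reverse of the slid one; the contours are
    then restored literally. *)
Lemma Psi_plusK x y x' : inN x -> Psi_minus o x y -> Psi_plus o y x' -> iso_N x' x.
Proof.
case: x => m j [/= hm jf] [d0 [f2 [fs [s [/= lm lg sp ->]]]]].
rewrite lm /= in jf; have [us hmt lgt lv] := Psi_minus_spec hm lm jf lg sp.
case=> f2t [fst [e1 [s' [/= [<- <-] lg' _ _ ->]]]].
have revE : rev (d0 :: s) = e1 :: s' by apply: lightest_det lgt lg'.
have ok : faces_ok m by case: hm.
split=> /=; last exact: (index_sss_minus ok lm us jf revE).
exists id; split=> //; first by exists id.
rewrite -(sss_minusK ok lm us jf revE) [in RHS]map_id_in // => g _.
by rewrite map_id.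
Qed.

Lemma Psi_minusK y x y' : inNt y -> Psi_plus o y x -> Psi_minus o x y' -> iso_Nt y' y.
Proof.
case: y => -[E ls D] v e [/= hM vM xf lv] [f2 [fs [e1 [s' [/= lM lg sp ef2 ->]]]]].
have ee1 := Psi_plus_first lv lg; rewrite -ee1 in lg.
have us := simple_path_uniq sp; have [d0 [s revE]] := rev_consE e1 s'.
have [hN vE lgN] := Psi_plus_spec hM lM ef2 lg us revE.
have lN := sss_plus_light f2 fs revE.
case=> d0' [f2' [fs' [t [lN' lg' _ ->]]]].
move: lN'; rewrite [light _]lN => -[? ? ?]; subst d0' f2' fs'.
have ts : s = t by apply: lightest_det lgN lg'.
have [le _] := rev_path_last (rev_swap revE).
have ok : faces_ok (ShadedMap ls D) by case: hM.
subst t; rewrite /= /sss_minus.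
have := sss_plusK ok lM ef2 us revE; rewrite /= => ->.
exists id; split; [split=> //; first by exists id| |].
- by rewrite [in RHS]map_id_in // => g _; rewrite map_id.
- by rewrite /= imset_id vE.
- by rewrite /= le ee1.
Qed.

Lemma iso_corner_vertex m m' (f : edge m -> edge m') (d0 : edge m) g j :
  is_iso f -> faces_ok m ->
  corner_vertex (f d0) (map f g) j = f @: corner_vertex d0 g j.
Proof.
move=> iso ok; rewrite /corner_vertex -(iso_origin iso ok) -map_rot; congr origin.
by case: (rot j g).
Qed.

Lemma Psi_minus_iso x x' y y' : inN x -> inN x' -> iso_N x x' ->
  Psi_minus o x y -> Psi_minus o x' y' -> iso_Nt y y'.
Proof.
case: x => m j; case: x' => m' j' [/= hm jf] _ [/= [f iso] <-].
case=> d0 [f2 [fs [s [/= lm lg sp ->]]]] [d0' [f2' [fs' [s' [/= lm' lg' _ ->]]]]].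
rewrite lm /= in jf; have [us hmt _ _] := Psi_minus_spec hm lm jf lg sp.
have [bij lE dE] := iso; have inj := iso_inj iso; have ok : faces_ok m by case: hm.
move: lm'; rewrite lE lm => -[? ? ?]; subst d0' f2' fs'.
have ss : map f s = s'.
  apply: lightest_det lg'; rewrite iso_corner_vertex //.
  exact: iso_lightest.
subst s'.
have isot : @is_iso (sss_minus d0 f2 fs j s) (sss_minus (f d0) (map f f2) (map (map f) fs) j (map f s)) f.
  by split=> //=; rewrite map_insert_at last_map map_slide_map // maps_slide_map.
exists f; split=> //=; last exact: last_map.
by apply: (iso_origin isot); case: hmt.
Qed.

Lemma Psi_plus_iso y y' x x' : inNt y -> inNt y' -> iso_Nt y y' ->
  Psi_plus o y x -> Psi_plus o y' x' -> iso_N x x'.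
Proof.
case: y => M v e; case: y' => M' v' e' [/= hM vM xf lv] _ [f [/= iso vE eE]].
case=> f2 [fs [e1 [s [/= lM lg sp ef2 ->]]]] [f2' [fs' [e1' [s' [/= lM' lg' _ _ ->]]]]].
have [bij lE dE] := iso; have inj := iso_inj iso; have ok : faces_ok M by case: hM.
move: lM'; rewrite lE lM => -[? ?]; subst f2' fs'; rewrite vE eE in lg'.
have [? ?] : map f (e1 :: s) = e1' :: s'.
  by apply: lightest_det lg'; apply: iso_lightest.
subst e1' s'; split=> /=; last by rewrite index_map.
exists f; split=> //=; rewrite last_map rem_map // map_slide_map // maps_slide_map //.
Qed.

End Psi.

Theorem theorem3p3 (p a2 : nat) (b : seq nat) (o : orientation)
  (a := 1 :: a2 :: b) (a' := a2.+1 :: b) :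
  2 <= p ->
  all (fun n => 0 < n) a ->
  all (fun n => 0 < n) a' ->
  count (fun n => ~~ (p %| n)) a <= 2 ->
  count (fun n => ~~ (p %| n)) a' <= 2 ->
  [/\ well_defined (is_N p a) iso_N (is_Nt p a' o) iso_Nt (Psi_minus o),
      well_defined (is_Nt p a' o) iso_Nt (is_N p a) iso_N (Psi_plus o),
      left_inverse_of (is_N p a) iso_N (Psi_minus o) (Psi_plus o)
    & left_inverse_of (is_Nt p a' o) iso_Nt (Psi_plus o) (Psi_minus o)].
Proof.
move=> _ /and3P[_ a2_gt0 _] _ _ _; split.
- split; [exact: Psi_minus_exists|exact: Psi_minus_in|exact: Psi_minus_iso].
- split; [exact: Psi_plus_exists|exact: Psi_plus_in|exact: Psi_plus_iso].
- exact: Psi_plusK.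
- exact: Psi_minusK.
Qed.
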